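(* Let $\mathcal{C}$ be an abelian category, let $(\mathcal{A},\mathcal{B})$ be a GP-admissible pair and $(\mathcal{Z},\mathcal{W})$ a GI-admissible pair in $\mathcal{C}$, and put $\omega := \mathcal{A}\cap\mathcal{B}$ and $\nu := \mathcal{Z}\cap\mathcal{W}$. Assume that: (1) $\omega$ and $\nu$ are closed under direct summands; (2) $\mathrm{Ext}^1(M,V)=0$ for every $M\in\pi\mathcal{GP}_{(\omega,\mathcal{B},1)}$ and $V\in\nu$, and $\mathrm{Ext}^1(W,N)=0$ for every $W\in\omega$ and $N\in\pi\mathcal{GI}_{(\mathcal{Z},\nu,1)}$; (3) every object in $\pi\mathcal{GP}_{(\omega,\mathcal{B},1)}$ admits a $\mathrm{Hom}(-,\nu)$-acyclic $\nu$-coresolution, and every object in $\pi\mathcal{GI}_{(\mathcal{Z},\nu,1)}$ admits a $\mathrm{Hom}(\omega,-)$-acyclic $\omega$-resolution. Then $$\mathrm{Gid}_{(\mathcal{Z},\mathcal{W})}\big(\pi\mathcal{GP}_{(\omega,\mathcal{B},1)}\cap\mathcal{I}_{\mathcal{Z}}^{<\infty}\big)\le \mathrm{Gid}_{(\mathcal{Z},\mathcal{W})}(\omega)$$ and $$\mathrm{Gpd}_{(\mathcal{A},\mathcal{B})}\big(\pi\mathcal{GI}_{(\mathcal{Z},\nu,1)}\cap\mathcal{P}_{\mathcal{B}}^{<\infty}\big)\le \mathrm{Gpd}_{(\mathcal{A},\mathcal{B})}(\nu).$$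
   Context: All classes of objects of the abelian category $\mathcal{C}$ are closed under isomorphisms. $\mathrm{Ext}^i$ denotes (Yoneda) extension groups in $\mathcal{C}$. All dimensions take values in $\mathbb{N}\cup\{\infty\}$. GP-admissible pair: a pair $(\mathcal{A},\mathcal{B})$ of classes of objects of $\mathcal{C}$ such that (i) $\mathrm{Ext}^i(A,B)=0$ for all $A\in\mathcal{A}$, $B\in\mathcal{B}$, $i\ge 1$; (ii) every object of $\mathcal{C}$ is an epimorphic image of an object of $\mathcal{A}$; (iii) $\mathcal{A}$ and $\mathcal{B}$ are closed under finite coproducts and $\mathcal{A}$ is closed under extensions; (iv) for every $A\in\mathcal{A}$ there is a short exact sequence $0\to A\to W\to A'\to 0$ with $W\in\mathcal{A}\cap\mathcal{B}$ and $A'\in\mathcal{A}$. GI-admissible pair (dual notion): a pair $(\mathcal{Z},\mathcal{W})$ such that (i) $\mathrm{Ext}^i(Z,W)=0$ for all $Z\in\mathcal{Z}$, $W\in\mathcal{W}$, $i\ge1$; (ii) every object of $\mathcal{C}$ embeds in an object of $\mathcal{W}$; (iii) $\mathcal{Z}$ and $\mathcal{W}$ are closed under finite coproducts and $\mathcal{W}$ is closed under extensions; (iv) for every $W\in\mathcal{W}$ there is a short exact sequence $0\to W'\to V\to W\to 0$ with $V\in\mathcal{Z}\cap\mathcal{W}$ and $W'\in\mathcal{W}$. A complex (or sequence) $X_\bullet$ is $\mathrm{Hom}(-,\mathcal{X})$-acyclic (resp. $\mathrm{Hom}(\mathcal{X},-)$-acyclic) if $\mathrm{Hom}(X_\bullet,X)$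 (resp. $\mathrm{Hom}(X,X_\bullet)$) is exact for every $X\in\mathcal{X}$. For classes $\mathcal{X},\mathcal{Y}$: $\mathcal{GP}_{(\mathcal{X},\mathcal{Y})}$ is the class of $(\mathcal{X},\mathcal{Y})$-Gorenstein projective objects, i.e. objects isomorphic to a cycle $Z_0(X_\bullet)$ of an exact, $\mathrm{Hom}(-,\mathcal{Y})$-acyclic (unbounded) complex $X_\bullet$ with all $X_k\in\mathcal{X}$. $\mathcal{GI}_{(\mathcal{X},\mathcal{Y})}$ is the class of $(\mathcal{X},\mathcal{Y})$-Gorenstein injective objects, i.e. objects isomorphic to a cycle $Z_0(Y_\bullet)$ of an exact, $\mathrm{Hom}(\mathcal{X},-)$-acyclic complex $Y_\bullet$ with all $Y_k\in\mathcal{Y}$. $\pi\mathcal{GP}_{(\omega,\mathcal{B},1)}$ ($1$-periodic $(\omega,\mathcal{B})$-Gorenstein projective objects) is the class of objects $M$ for which there is a $\mathrm{Hom}(-,\mathcal{B})$-acyclic short exact sequence $0\to M\to W\to M\to 0$ with $W\in\omega$. $\pi\mathcal{GI}_{(\mathcal{Z},\nu,1)}$ ($1$-periodic $(\mathcal{Z},\nu)$-Gorenstein injective objects) is the class of objects $N$ for which there is a $\mathrm{Hom}(\mathcal{Z},-)$-acyclic short exact sequence $0\to N\to V\to N\to 0$ with $V\in\nu$. An $\mathcal{X}$-resolution of $C$ is an exact sequence $\cdots\to X_1\to X_0\to C\to 0$ with all $X_k\in\mathcal{X}$ (possibly infinite); an $\mathcal{X}$-coresolution is an exact sequence $0\to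 C\to X^0\to X^1\to\cdots$ with all $X^k\in\mathcal{X}$. $\mathrm{resdim}_{\mathcal{X}}(C)$ is the least $n\ge0$ such that there is an exact sequence $0\to X_n\to\cdots\to X_0\to C\to0$ with all $X_k\in\mathcal{X}$ ($\infty$ if none exists); $\mathrm{coresdim}_{\mathcal{X}}(C)$ is defined dually with $0\to C\to X^0\to\cdots\to X^n\to 0$. $\mathrm{Gpd}_{(\mathcal{A},\mathcal{B})}(C):=\mathrm{resdim}_{\mathcal{GP}_{(\mathcal{A},\mathcal{B})}}(C)$ and $\mathrm{Gid}_{(\mathcal{Z},\mathcal{W})}(C):=\mathrm{coresdim}_{\mathcal{GI}_{(\mathcal{Z},\mathcal{W})}}(C)$. For a class of objects, each dimension is the supremum of the dimensions of its members. $\mathrm{pd}_{\mathcal{B}}(M)$ is the least $n\ge0$ with $\mathrm{Ext}^i(M,B)=0$ for all $i>n$, $B\in\mathcal{B}$ ($\infty$ if none); $\mathrm{id}_{\mathcal{Z}}(M)$ is the least $n\ge0$ with $\mathrm{Ext}^i(Z,M)=0$ for all $i>n$, $Z\in\mathcal{Z}$ ($\infty$ if none). $\mathcal{I}_{\mathcal{Z}}^{<\infty}$ is the class of objects $M$ with $\mathrm{id}_{\mathcal{Z}}(M)<\infty$, and $\mathcal{P}_{\mathcal{B}}^{<\infty}$ the class of objects $M$ with $\mathrm{pd}_{\mathcal{B}}(M)<\infty$. *)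

(* Defs.v *)
From HB Require Import structures.
From mathcomp Require Import all_boot all_order all_algebra.
From mathcomp Require Import boolp classical_sets.
From Stdlib Require Import Relation_Operators.

Set Implicit Arguments.
Unset Strict Implicit.
Unset Printing Implicit Defensive.

Import GRing.Theory.
Local Open Scope ring_scope.
Local Open Scope classical_set_scope.

(* N u {oo}: [Some n] is the natural number n and [None] is oo. *)
Definition enat : Type := option nat.

Definition enat_le (x y : enat) : bool :=
  match x, y with
  | _, None => true
  | None, Some _ => false
  | Some m, Some n => (m <= n)%N
  end.

(* The least element of P, and oo if P is empty. *)
Definition enat_least (P : set nat) : enat :=
  match pselect (exists n, `[< P n >]) with
  | left h => Some (@ex_minn (fun n => `[< P n >]) h)
  | right _ => None
  end.

(* The supremum in N u {oo}; in particular it is 0 for the empty set. *)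
Definition enat_sup (S : set enat) : enat :=
  enat_least [set n | forall x, S x -> enat_le x (Some n)].

Record preadditiveCat := PreadditiveCat {
  obj :> Type;
  hom : obj -> obj -> zmodType;
  idm : forall A, hom A A;
  comp : forall A B D, hom B D -> hom A B -> hom A D;
  compA : forall A B D E (h : hom D E) (g : hom B D) (f : hom A B),
    comp h (comp g f) = comp (comp h g) f;
  comp1m : forall A B (f : hom A B), comp (idm B) f = f;
  compm1 : forall A B (f : hom A B), comp f (idm A) = f;
  compDl : forall A B D (g g' : hom B D) (f : hom A B),
    comp (g + g') f = comp g f + comp g' f;
  compDr : forall A B D (g : hom B D) (f f' : hom A B),
    comp g (f + f') = comp g f + comp g f'
}.

Notation "g \oc f" := (comp g f) (at level 40, left associativity).

Section Preadditive.
Context {C : preadditiveCat}.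
Implicit Types A B D K Q S M N T : C.

Definition is_mono A B (f : hom A B) : Prop :=
  forall T (u v : hom T A), f \oc u = f \oc v -> u = v.

Definition is_epi A B (f : hom A B) : Prop :=
  forall T (u v : hom B T), u \oc f = v \oc f -> u = v.

Definition is_iso A B (f : hom A B) : Prop :=
  exists g : hom B A, g \oc f = idm A /\ f \oc g = idm B.

Definition isomorphic A B : Prop := exists f : hom A B, is_iso f.

Definition is_zero Z : Prop :=
  forall A, (forall f : hom Z A, f = 0) /\ (forall f : hom A Z, f = 0).

Definition is_kernel A B (f : hom A B) K (k : hom K A) : Prop :=
  f \oc k = 0 /\
  forall T (u : hom T A), f \oc u = 0 -> exists! v : hom T K, k \oc v = u.

Definition is_cokernel A B (f : hom A B) Q (q : hom B Q) : Prop :=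
  q \oc f = 0 /\
  forall T (u : hom B T), u \oc f = 0 -> exists! v : hom Q T, v \oc q = u.

Definition is_biproduct A B S : Prop :=
  exists (iA : hom A S) (iB : hom B S) (pA : hom S A) (pB : hom S B),
    [/\ pA \oc iA = idm A, pB \oc iB = idm B, pA \oc iB = 0, pB \oc iA = 0
      & iA \oc pA + iB \oc pB = idm S].

Definition is_coproduct n (F : 'I_n -> C) S (inj : forall i, hom (F i) S)
    : Prop :=
  forall T (u : forall i, hom (F i) T),
    exists! v : hom S T, forall i, v \oc inj i = u i.

(* Exactness at B: the image of f (the subobject in its epi-mono
   factorization) is the kernel of g. *)
Definition exact A B D (f : hom A B) (g : hom B D) : Prop :=
  exists K (k : hom K B) (e : hom A K),
    [/\ is_kernel g k, is_epi e & f = k \oc e].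

Definition short_exact A B D (f : hom A B) (g : hom B D) : Prop :=
  [/\ is_mono f, exact f g & is_epi g].

Definition iso_closed (X : set C) : Prop :=
  forall A B, isomorphic A B -> X A -> X B.

(* The case n = 0 says that zero objects belong to X. *)
Definition coproduct_closed (X : set C) : Prop :=
  forall n (F : 'I_n -> C) S (inj : forall i, hom (F i) S),
    is_coproduct inj -> (forall i, X (F i)) -> X S.

Definition extension_closed (X : set C) : Prop :=
  forall A B D (f : hom A B) (g : hom B D),
    short_exact f g -> X A -> X D -> X B.

Definition summand_closed (X : set C) : Prop :=
  forall A B S, is_biproduct A B S -> X S -> X A.

End Preadditive.

Record abelianCat := AbelianCat {
  abelian_base :> preadditiveCat;
  abelian_zero : exists Z : abelian_base, is_zero Z;
  abelian_biproduct : forall A B : abelian_base, exists S, is_biproduct A B S;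
  abelian_kernel : forall (A B : abelian_base) (f : hom A B),
    exists K (k : hom K A), is_kernel f k;
  abelian_cokernel : forall (A B : abelian_base) (f : hom A B),
    exists Q (q : hom B Q), is_cokernel f q;
  abelian_mono_normal : forall (A B : abelian_base) (f : hom A B),
    is_mono f -> exists D (g : hom B D), is_kernel g f;
  abelian_epi_normal : forall (A B : abelian_base) (f : hom A B),
    is_epi f -> exists D (g : hom D A), is_cokernel g f
}.

Section Abelian.
Context {C : abelianCat}.
Implicit Types A B D M N T : C.
Implicit Types X Y : set C.

Definition exactZ (U V W : zmodType) (u : U -> V) (v : V -> W) : Prop :=
  forall y, v y = 0 <-> exists x, u x = y.

Definition surj (U V : Type) (u : U -> V) : Prop := forall y, exists x, u x = y.

(* Hom(f, T) and Hom(T, f) *)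
Definition precomp T A B (f : hom A B) (h : hom B T) : hom A T := h \oc f.
Definition postcomp T A B (f : hom A B) (h : hom T A) : hom T B := f \oc h.

Definition ses_hom_to_acyclic Y A B D (f : hom A B) (g : hom B D) : Prop :=
  forall T, Y T ->
    [/\ injective (precomp (T := T) g),
        exactZ (precomp (T := T) g) (precomp (T := T) f)
      & surj (precomp (T := T) f)].

Definition ses_hom_from_acyclic Y A B D (f : hom A B) (g : hom B D) : Prop :=
  forall T, Y T ->
    [/\ injective (postcomp (T := T) f),
        exactZ (postcomp (T := T) f) (postcomp (T := T) g)
      & surj (postcomp (T := T) g)].

(* ... -> P 1 -> P 0 -> M -> 0 is exact. *)
Definition is_resolution M (P : nat -> C)
    (d : forall k, hom (P k.+1) (P k)) (e : hom (P 0) M) : Prop :=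
  [/\ is_epi e, exact (d 0%N) e & forall k, exact (d k.+1) (d k)].

(* 0 -> M -> I 0 -> I 1 -> ... is exact. *)
Definition is_coresolution M (I : nat -> C)
    (d : forall k, hom (I k) (I k.+1)) (e : hom M (I 0)) : Prop :=
  [/\ is_mono e, exact e (d 0%N) & forall k, exact (d k) (d k.+1)].

Definition has_acyclic_resolution Y X M : Prop :=
  exists (P : nat -> C) (d : forall k, hom (P k.+1) (P k)) (e : hom (P 0) M),
    [/\ is_resolution d e, forall k, X (P k)
      & forall T, Y T ->
          [/\ surj (postcomp (T := T) e),
              exactZ (postcomp (T := T) (d 0%N)) (postcomp (T := T) e)
            & forall k, exactZ (postcomp (T := T) (d k.+1))
                               (postcomp (T := T) (d k))]].

Definition has_acyclic_coresolution Y X M : Prop :=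
  exists (I : nat -> C) (d : forall k, hom (I k) (I k.+1)) (e : hom M (I 0)),
    [/\ is_coresolution d e, forall k, X (I k)
      & forall T, Y T ->
          [/\ surj (precomp (T := T) e),
              exactZ (precomp (T := T) (d 0%N)) (precomp (T := T) e)
            & forall k, exactZ (precomp (T := T) (d k.+1))
                               (precomp (T := T) (d k))]].

(* A finite exact sequence 0 -> P n -> ... -> P 0 -> M -> 0 is encoded as an
   infinite one whose terms of index greater than n are zero objects. *)
Definition has_finite_resolution X (n : nat) M : Prop :=
  exists (P : nat -> C) (d : forall k, hom (P k.+1) (P k)) (e : hom (P 0) M),
    [/\ is_resolution d e, forall k, (k <= n)%N -> X (P k)
      & forall k, (n < k)%N -> is_zero (P k)].

Definition has_finite_coresolution X (n : nat) M : Prop :=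
  exists (I : nat -> C) (d : forall k, hom (I k) (I k.+1)) (e : hom M (I 0)),
    [/\ is_coresolution d e, forall k, (k <= n)%N -> X (I k)
      & forall k, (n < k)%N -> is_zero (I k)].

Definition resdim X M : enat :=
  enat_least [set n | has_finite_resolution X n M].

Definition coresdim X M : enat :=
  enat_least [set n | has_finite_coresolution X n M].

(* For n >= 1, an n-fold extension 0 -> B -> E_(n-1) -> ... -> E_0 -> A -> 0,
   encoded as an exact sequence ending at A, vanishing above degree n and with
   its degree n term identified with B. *)
Record yext (n : nat) A B := Yext {
  yext_obj : nat -> C;
  yext_d : forall k, hom (yext_obj k.+1) (yext_obj k);
  yext_proj : hom (yext_obj 0) A;
  yext_inj : hom B (yext_obj n);
  yext_exact : is_resolution yext_d yext_proj;
  yext_above : forall k, (n < k)%N -> is_zero (yext_obj k);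
  yext_inj_iso : is_iso yext_inj
}.

(* Morphisms of n-fold extensions inducing the identity on A and B. *)
Definition yext_mor n A B (E F : yext n A B) : Prop :=
  exists f : forall k, hom (yext_obj E k) (yext_obj F k),
    [/\ forall k, f k \oc yext_d E k = yext_d F k \oc f k.+1,
        yext_proj F \oc f 0%N = yext_proj E
      & f n \oc yext_inj E = yext_inj F].

Definition yext_equiv n A B : yext n A B -> yext n A B -> Prop :=
  clos_refl_sym_trans (yext n A B) (@yext_mor n A B).

(* Ext^n(A, B) = 0 for n >= 1. The elements of the Yoneda group Ext^n(A, B) are
   the classes of n-fold extensions under yext_equiv, so the group is zero iff
   there is only one class. Not meaningful for n = 0. *)
Definition Ext_zero (n : nat) A B : Prop := forall E F : yext n A B, yext_equiv E F.

Definition pd Y M : enat :=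
  enat_least [set n | forall i T, (n < i)%N -> Y T -> Ext_zero i M T].

Definition id_dim Y M : enat :=
  enat_least [set n | forall i T, (n < i)%N -> Y T -> Ext_zero i T M].

Definition finite_pd Y : set C := [set M | pd Y M <> None].
Definition finite_id Y : set C := [set M | id_dim Y M <> None].

(* Complexes ... -> P (k + 1) -> P k -> P (k - 1) -> ..., with d k starting at
   P k. *)
Definition GProj X Y : set C := [set M |
  exists (P : int -> C) (d : forall k, hom (P k) (P (k - 1))),
    [/\ forall k : int, exact (d k) (d (k - 1)),
        forall k : int, X (P k),
        forall T, Y T -> forall k : int,
          exactZ (precomp (T := T) (d (k - 1))) (precomp (T := T) (d k))
      & exists (Z0 : C) (i : hom Z0 (P 0)),
          is_kernel (d 0) i /\ isomorphic M Z0]].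

Definition GInj X Y : set C := [set M |
  exists (P : int -> C) (d : forall k, hom (P k) (P (k - 1))),
    [/\ forall k : int, exact (d k) (d (k - 1)),
        forall k : int, Y (P k),
        forall T, X T -> forall k : int,
          exactZ (postcomp (T := T) (d k)) (postcomp (T := T) (d (k - 1)))
      & exists (Z0 : C) (i : hom Z0 (P 0)),
          is_kernel (d 0) i /\ isomorphic M Z0]].

Definition piGProj omega Y : set C := [set M |
  exists (W : C) (f : hom M W) (g : hom W M),
    [/\ short_exact f g, ses_hom_to_acyclic Y f g & omega W]].

Definition piGInj X nu : set C := [set N |
  exists (V : C) (f : hom N V) (g : hom V N),
    [/\ short_exact f g, ses_hom_from_acyclic X f g & nu V]].

Definition Gpd X Y M : enat := resdim (GProj X Y) M.
Definition Gid X Y M : enat := coresdim (GInj X Y) M.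

Definition Gpd_class X Y (S : set C) : enat := enat_sup (Gpd X Y @` S).
Definition Gid_class X Y (S : set C) : enat := enat_sup (Gid X Y @` S).

Record GP_admissible (A B : set C) : Prop := GPAdmissible {
  GP_isoA : iso_closed A;
  GP_isoB : iso_closed B;
  GP_ext : forall M N i, A M -> B N -> (1 <= i)%N -> Ext_zero i M N;
  GP_epi : forall M, exists (X : C) (p : hom X M), A X /\ is_epi p;
  GP_coprodA : coproduct_closed A;
  GP_coprodB : coproduct_closed B;
  GP_extclosed : extension_closed A;
  GP_embed : forall M, A M ->
    exists (W M' : C) (f : hom M W) (g : hom W M'),
      [/\ short_exact f g, (A `&` B) W & A M']
}.

Record GI_admissible (Z W : set C) : Prop := GIAdmissible {
  GI_isoZ : iso_closed Z;
  GI_isoW : iso_closed W;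
  GI_ext : forall M N i, Z M -> W N -> (1 <= i)%N -> Ext_zero i M N;
  GI_mono : forall M, exists (X : C) (j : hom M X), W X /\ is_mono j;
  GI_coprodZ : coproduct_closed Z;
  GI_coprodW : coproduct_closed W;
  GI_extclosed : extension_closed W;
  GI_cover : forall M, W M ->
    exists (V M' : C) (f : hom M' V) (g : hom V M),
      [/\ short_exact f g, (Z `&` W) V & W M']
}.

End Abelian.

(* Main.v *)
From mathcomp Require Import all_boot all_order all_algebra.
From mathcomp Require Import boolp classical_sets.
Require Import Defs.

(** The two inequalities are one statement read in a category and in its
    opposite [op C], so the argument is carried out for [Gpd] over an abstract
    predicate [E] of vanishing of Ext, and used a second time over [op C].

    Let 0 -> N -> V -> N -> 0 be exact with V in nu and let n bound the
    Gorenstein projective dimension of V. Since Ext^1(omega, N) = 0, the first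
    step K -> U -> N of the given omega-resolution of N lifts to V, and the
    horseshoe gives 0 -> K -> V' -> K -> 0 where V' is a syzygy of V
    ([horseshoe_op]). First syzygies of an object of dimension at most n + 1 have
    dimension at most n ([ses_resdim_syzygy]), so after n steps V' is Gorenstein
    projective. By then the finiteness of pd_B N forces Ext^i(K, B) = 0 for all
    i >= 1, because the sequence 0 -> K -> V' -> K -> 0 shifts the degree by one
    without changing the object; and splicing this sequence with itself
    coresolves K by Gorenstein projectives, which makes K Gorenstein projective
    ([periodic_resdim]). Hence N has dimension at most n.

    For this the class of Gorenstein projectives must be closed under extensions
    and under kernels of epimorphisms. Both are coinductive arguments for [gproj],
    a largest class of objects with a coresolution step, once the terms of these
    coresolutions can be taken Ext-injective relative to the whole class; that
    the objects defined by unbounded complexes are the same ones is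
    [GProj_gorenstein] followed by [gorenstein_gproj].

    Vanishing of Ext is stated with Yoneda extensions up to zigzags. It is used
    only through two consequences: extensions split in degree one, and degrees
    can be shifted along a short exact sequence, in the first variable for one
    half and in the second variable for the other. Both are read off from a test
    on resolutions, [ext_vanish]: every cocycle on a resolution of M becomes a
    coboundary on a finer resolution. That the vanishing of the Yoneda group
    implies it ([ext_zero_vanish]) rests on [homotopy_pullback], which refines
    two resolutions mapping to a third one, so that being killed by a refinement
    is invariant under the zigzags. *)

Set Implicit Arguments.
Unset Strict Implicit.
Unset Printing Implicit Defensive.
Import GRing.Theory.
Local Open Scope classical_set_scope.

(** * Additive calculus *)

Section Additive.
Local Open Scope ring_scope.
Context {C : preadditiveCat}.
Implicit Types A B D T : C.

Lemma comp0m A B D (f : hom A B) : (0 : hom B D) \oc f = 0.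
Proof. by apply: (addrI (0 \oc f)); rewrite -compDl !addr0. Qed.

Lemma compm0 A B D (g : hom B D) : g \oc (0 : hom A B) = 0.
Proof. by apply: (addrI (g \oc 0)); rewrite -compDr !addr0. Qed.

Lemma compNm A B D (g : hom B D) (f : hom A B) : (- g) \oc f = - (g \oc f).
Proof. by apply: (addrI (g \oc f)); rewrite -compDl !subrr comp0m. Qed.

Lemma compmN A B D (g : hom B D) (f : hom A B) : g \oc (- f) = - (g \oc f).
Proof. by apply: (addrI (g \oc f)); rewrite -compDr !subrr compm0. Qed.

Lemma compBm A B D (g g' : hom B D) (f : hom A B) :
  (g - g') \oc f = g \oc f - g' \oc f.
Proof. by rewrite compDl compNm. Qed.

Lemma compmB A B D (g : hom B D) (f f' : hom A B) :
  g \oc (f - f') = g \oc f - g \oc f'.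
Proof. by rewrite compDr compmN. Qed.

Lemma epiP A B (f : hom A B) :
  is_epi f <-> forall T (u : hom B T), u \oc f = 0 -> u = 0.
Proof.
split=> [ef T u uf0 | ef T u v euv]; first by apply: ef; rewrite uf0 comp0m.
by apply/subr0_eq/ef; rewrite compBm euv subrr.
Qed.

Lemma monoP A B (f : hom A B) :
  is_mono f <-> forall T (u : hom T A), f \oc u = 0 -> u = 0.
Proof.
split=> [mf T u fu0 | mf T u v euv]; first by apply: mf; rewrite fu0 compm0.
by apply/subr0_eq/mf; rewrite compmB euv subrr.
Qed.

Lemma epi_comp A B D (g : hom B D) (f : hom A B) :
  is_epi f -> is_epi g -> is_epi (g \oc f).
Proof. by move=> ef eg T u v; rewrite !compA => /ef /eg. Qed.

Lemma mono_comp A B D (g : hom B D) (f : hom A B) :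
  is_mono f -> is_mono g -> is_mono (g \oc f).
Proof. by move=> mf mg T u v; rewrite -!compA => /mg /mf. Qed.

Lemma epi_compl A B D (g : hom B D) (f : hom A B) :
  is_epi (g \oc f) -> is_epi g.
Proof. by move=> e T u v euv; apply: e; rewrite !compA euv. Qed.

Lemma epi_idm A : is_epi (idm A).
Proof. by move=> T u v; rewrite !compm1. Qed.

Lemma mono_idm A : is_mono (idm A).
Proof. by move=> T u v; rewrite !comp1m. Qed.

Lemma kernel_mono A B K (f : hom A B) (k : hom K A) :
  is_kernel f k -> is_mono k.
Proof.
move=> [fk0 uk] T u v e.
have [|w [_ uw]] := uk T (k \oc u); first by rewrite compA fk0 comp0m.
by rewrite -(uw u) // (uw v).
Qed.

End Additive.

Section Biproduct.
Local Open Scope ring_scope.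
Context {C : abelianCat}.
Implicit Types A B D T X Y Z : C.

Record biprod A B := Biprod {
  bip_obj :> C;
  in1 : hom A bip_obj; in2 : hom B bip_obj;
  pr1 : hom bip_obj A; pr2 : hom bip_obj B;
  pr1_in1 : pr1 \oc in1 = idm A; pr2_in2 : pr2 \oc in2 = idm B;
  pr1_in2 : pr1 \oc in2 = 0; pr2_in1 : pr2 \oc in1 = 0;
  in_pr : in1 \oc pr1 + in2 \oc pr2 = idm bip_obj
}.

Lemma biprod_inhabited A B : exists _ : biprod A B, True.
Proof.
have [S [iA [iB [pA [pB [e1 e2 e3 e4 e5]]]]]] := abelian_biproduct A B.
by exists (Biprod e1 e2 e3 e4 e5).
Qed.

Definition bip A B : biprod A B := sval (cid (biprod_inhabited A B)).

Definition pairm A B T (u : hom T A) (v : hom T B) : hom T (bip A B) :=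
  in1 _ \oc u + in2 _ \oc v.

Definition copairm A B T (u : hom A T) (v : hom B T) : hom (bip A B) T :=
  u \oc pr1 _ + v \oc pr2 _.

Lemma pr1_pair A B T (u : hom T A) (v : hom T B) : pr1 _ \oc pairm u v = u.
Proof. by rewrite compDr !compA pr1_in1 pr1_in2 comp1m comp0m addr0. Qed.

Lemma pr2_pair A B T (u : hom T A) (v : hom T B) : pr2 _ \oc pairm u v = v.
Proof. by rewrite compDr !compA pr2_in1 pr2_in2 comp1m comp0m add0r. Qed.

Lemma pair_eta A B T (x : hom T (bip A B)) :
  x = pairm (pr1 _ \oc x) (pr2 _ \oc x).
Proof. by rewrite /pairm !compA -compDl in_pr comp1m. Qed.

Lemma pair_comp A B T X (u : hom T A) (v : hom T B) (w : hom X T) :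
  pairm u v \oc w = pairm (u \oc w) (v \oc w).
Proof. by rewrite /pairm compDl !compA. Qed.

Lemma copair_pair A B T X (u : hom A T) (v : hom B T) (a : hom X A) (b : hom X B) :
  copairm u v \oc pairm a b = u \oc a + v \oc b.
Proof. by rewrite compDl -!compA pr1_pair pr2_pair. Qed.

Lemma copair_in1 A B T (u : hom A T) (v : hom B T) : copairm u v \oc in1 _ = u.
Proof. by rewrite compDl -!compA pr1_in1 pr2_in1 compm1 compm0 addr0. Qed.

Lemma copair_in2 A B T (u : hom A T) (v : hom B T) : copairm u v \oc in2 _ = v.
Proof. by rewrite compDl -!compA pr1_in2 pr2_in2 compm1 compm0 add0r. Qed.

Lemma pair_inj A B T (u u' : hom T A) (v v' : hom T B) :
  pairm u v = pairm u' v' -> u = u' /\ v = v'.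
Proof. by move=> e; rewrite -(pr1_pair u v) -{2}(pr2_pair u v) e pr1_pair pr2_pair. Qed.

Lemma pair0 A B T : pairm (0 : hom T A) (0 : hom T B) = 0.
Proof. by rewrite /pairm !compm0 addr0. Qed.

End Biproduct.

(** * Exactness through generalized elements *)

Section Elements.
Local Open Scope ring_scope.
Context {C : abelianCat}.
Implicit Types A B D T X Y Z : C.

Lemma epi_cokernel A B (f : hom A B) K (k : hom K A) :
  is_epi f -> is_kernel f k -> is_cokernel k f.
Proof.
move=> ef [fk0 uk]; split=> // T u uk0.
have [D [g [fg0 ug]]] := abelian_epi_normal ef.
have [h [kh _]] := uk _ _ fg0.
have ug0 : u \oc g = 0 by rewrite -kh compA uk0 comp0m.
exact: ug _ _ ug0.
Qed.

Lemma mono_kernel A B (f : hom A B) Q (q : hom B Q) :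
  is_mono f -> is_cokernel f q -> is_kernel q f.
Proof.
move=> mf [qf0 uq]; split=> // T u qu0.
have [D [g [gf0 ug]]] := abelian_mono_normal mf.
have [h [hq _]] := uq _ _ gf0.
have gu0 : g \oc u = 0 by rewrite -hq -compA qu0 compm0.
exact: ug _ _ gu0.
Qed.

(** In an abelian category epimorphisms are stable under pullback: the pullback is
    the kernel of X (+) Y -> Z, an epimorphism that is the cokernel of its kernel.
    This is what allows elements to be lifted locally. *)
Lemma pullback X Y Z (f : hom X Z) (g : hom Y Z) :
  exists P (p : hom P X) (q : hom P Y),
    [/\ f \oc p = g \oc q,
        forall T (u : hom T X) (v : hom T Y), f \oc u = g \oc v ->
          exists w : hom T P, p \oc w = u /\ q \oc w = v,
        forall T (w : hom T P), p \oc w = 0 -> q \oc w = 0 -> w = 0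
      & is_epi f -> is_epi q].
Proof.
pose s := copairm f (- g).
have [P [k kk]] := abelian_kernel s.
have [sk0 uk] := kk.
have sE T (x : hom T (bip X Y)) : s \oc x = f \oc (pr1 _ \oc x) - g \oc (pr2 _ \oc x).
  by rewrite {1}(pair_eta x) copair_pair compNm.
exists P, (pr1 _ \oc k), (pr2 _ \oc k); split.
- by apply/subr0_eq; rewrite -sE.
- move=> T u v e.
  have [|w [kw _]] := uk T (pairm u v).
    by rewrite sE pr1_pair pr2_pair e subrr.
  by exists w; rewrite -!compA kw pr1_pair pr2_pair.
- move=> T w; rewrite -!compA => e1 e2.
  apply: ((monoP k).1 (kernel_mono kk)).
  by rewrite (pair_eta (k \oc w)) e1 e2 pair0.
move=> ef; apply/epiP => T u uq0.
have es : is_epi s.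
  apply/epiP => T' v vs0; apply: ((epiP f).1 ef).
  by rewrite -(copair_in1 f (- g)) compA vs0 comp0m.
have [_ us] := epi_cokernel es kk.
have [|v [vs _]] := us _ (u \oc pr2 _); first by rewrite -compA.
have v0 : v = 0.
  apply: ((epiP f).1 ef); rewrite -(copair_in1 f (- g)) compA vs.
  by rewrite -compA pr2_in1 compm0.
by rewrite -[u]compm1 -(pr2_in2 (bip X Y)) compA -vs v0 !comp0m.
Qed.

Lemma epi_lift X Z T (f : hom X Z) (x : hom T Z) : is_epi f ->
  exists T' (q : hom T' T) (a : hom T' X), is_epi q /\ f \oc a = x \oc q.
Proof.
move=> ef; have [P [p [q [e _ _ eq]]]] := pullback f x.
by exists P, q, p; split=> //; apply: eq.
Qed.

(** Diagrams are chased with generalized elements: a map [x] into B that is killed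
    by the next map comes from A after composing with an epimorphism onto its
    source. *)
Lemma exactP A B D (f : hom A B) (g : hom B D) :
  exact f g <-> g \oc f = 0 /\
    forall T (x : hom T B), g \oc x = 0 ->
      exists T' (q : hom T' T) (a : hom T' A), is_epi q /\ f \oc a = x \oc q.
Proof.
split.
  move=> [K [k [e [[gk0 uk] ee ->]]]]; split; first by rewrite compA gk0 comp0m.
  move=> T x gx0; have [v [kv _]] := uk _ _ gx0.
  have [T' [q [a [eq ea]]]] := epi_lift v ee.
  by exists T', q, a; split; rewrite // -compA ea compA kv.
move=> [gf0 cov]; have [K [k kk]] := abelian_kernel g.
have [gk0 uk] := kk; have [e [ke _]] := uk _ _ gf0.
exists K, k, e; split=> //; have [T' [q [a [eq fa]]]] := cov _ _ gk0.
have qE : e \oc a = q by apply: (kernel_mono kk); rewrite compA ke.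
by apply: (@epi_compl _ _ _ _ _ a); rewrite qE.
Qed.

Lemma exactI A B D (f : hom A B) (g : hom B D) : g \oc f = 0 ->
  (forall T (x : hom T B), g \oc x = 0 ->
    exists T' (q : hom T' T) (a : hom T' A), is_epi q /\ f \oc a = x \oc q) ->
  exact f g.
Proof. by move=> ? ?; apply/exactP. Qed.

Lemma exact0 A B D (f : hom A B) (g : hom B D) : exact f g -> g \oc f = 0.
Proof. by case/exactP. Qed.

Lemma exact_lift A B D (f : hom A B) (g : hom B D) T (x : hom T B) :
  exact f g -> g \oc x = 0 ->
  exists T' (q : hom T' T) (a : hom T' A), is_epi q /\ f \oc a = x \oc q.
Proof. by move=> /exactP[_ h]; apply: h. Qed.

Lemma epiI X Z (f : hom X Z) :
  (forall T (x : hom T Z), exists T' (q : hom T' T) (a : hom T' X),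
     is_epi q /\ f \oc a = x \oc q) -> is_epi f.
Proof.
move=> h; have [T' [q [a [eq fa]]]] := h _ (idm Z).
by apply: (@epi_compl _ _ _ _ _ a); rewrite fa comp1m.
Qed.

(** Exactness is defined by the image being a kernel; here the coimage is a
    cokernel, which is the same condition in the opposite category. *)
Lemma exact_coexact A B D (f : hom A B) (g : hom B D) : exact f g ->
  exists Q (q : hom B Q) (m : hom Q D), [/\ is_cokernel f q, is_mono m & g = m \oc q].
Proof.
move=> ex; have [Q [q kq]] := abelian_cokernel f.
have [qf0 uq] := kq; have [m [mq _]] := uq _ _ (exact0 ex).
have eq : is_epi q.
  apply/epiP => T u uq0.
  have [|w [_ uw]] := uq T 0; first by rewrite comp0m.
  by rewrite -(uw u) // (uw 0) // comp0m.
exists Q, q, m; split=> //; apply/monoP => T x mx0.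
have [T' [p [b [ep qb]]]] := epi_lift x eq.
have gb : g \oc b = 0 by rewrite -mq -compA qb compA mx0 comp0m.
have [T2 [p2 [a [ep2 fa]]]] := exact_lift ex gb.
apply: ((epiP (p \oc p2)).1 (epi_comp ep2 ep)).
by rewrite compA -qb -compA -fa compA qf0 comp0m.
Qed.

End Elements.

(** * The opposite category *)

Section Opposite.
Local Open Scope ring_scope.

Definition op_pre (C : preadditiveCat) : preadditiveCat.
Proof.
refine (@PreadditiveCat (obj C) (fun A B => hom B A) (@idm C)
  (fun A B D g f => f \oc g) _ _ _ _ _).
- by move=> *; rewrite compA.
- by move=> *; rewrite compm1.
- by move=> *; rewrite comp1m.
- by move=> *; rewrite compDr.
- by move=> *; rewrite compDl.
Defined.

Definition op (C : abelianCat) : abelianCat.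
Proof.
refine (@AbelianCat (op_pre C) _ _ _ _ _ _).
- have [Z hZ] := abelian_zero C; exists Z => A.
  by have [] := hZ A.
- move=> A B; have [S [iA [iB [pA [pB [e1 e2 e3 e4 e5]]]]]] := abelian_biproduct A B.
  by exists S, pA, pB, iA, iB.
- by move=> A B f; have := @abelian_cokernel C _ _ f.
- by move=> A B f; have := @abelian_kernel C _ _ f.
- by move=> A B f; have := @abelian_epi_normal C _ _ f.
- by move=> A B f; have := @abelian_mono_normal C _ _ f.
Defined.

Lemma exact_op (C : abelianCat) (A B D : C) (f : hom A B) (g : hom B D) :
  exact f g <-> @exact (op C) D B A g f.
Proof.
split; first exact: exact_coexact.
exact: (@exact_coexact (op C) D B A g f).
Qed.

Lemma short_exact_op (C : abelianCat) (A B D : C) (f : hom A B) (g : hom B D) :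
  short_exact f g <-> @short_exact (op C) D B A g f.
Proof.
split=> [[mf ex eg]|[mg ex ef]]; split=> //; first exact: (exact_op f g).1.
exact: (exact_op f g).2.
Qed.

End Opposite.

(** * Short exact sequences *)

Section ShortExact.
Local Open Scope ring_scope.
Context {C : abelianCat}.
Implicit Types A B D G K L M N Q T U X Y Z : C.

Lemma ses0 A B D (f : hom A B) (g : hom B D) : short_exact f g -> g \oc f = 0.
Proof. by case=> _ /exact0. Qed.

Lemma ses_lift A B D (f : hom A B) (g : hom B D) T (x : hom T B) :
  short_exact f g -> g \oc x = 0 -> exists y : hom T A, f \oc y = x.
Proof.
move=> [mf ex _] gx0; have [Q [q [m [kq mm gE]]]] := exact_coexact ex.
have [_ uq] := mono_kernel mf kq.
have [|y [fy _]] := uq _ x; last by exists y.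
by apply: ((monoP m).1 mm); rewrite compA -gE.
Qed.

Lemma sesI A B D (f : hom A B) (g : hom B D) :
  is_mono f -> is_epi g -> g \oc f = 0 ->
  (forall T (x : hom T B), g \oc x = 0 ->
    exists T' (q : hom T' T) (a : hom T' A), is_epi q /\ f \oc a = x \oc q) ->
  short_exact f g.
Proof. by move=> mf eg gf0 h; split=> //; apply: exactI. Qed.

Lemma kernel_ses A B D (f : hom A B) (g : hom B D) :
  is_epi g -> is_kernel g f -> short_exact f g.
Proof.
move=> eg kf; have [gf0 uf] := kf.
apply: sesI => //; first exact: kernel_mono kf.
move=> T x gx0; have [y [fy _]] := uf _ _ gx0.
by exists T, (idm T), y; rewrite compm1; split=> //; apply: epi_idm.
Qed.

Lemma ses_of_epi B D (g : hom B D) :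
  is_epi g -> exists A (f : hom A B), short_exact f g.
Proof.
by move=> eg; have [A [f kf]] := abelian_kernel g; exists A, f; apply: kernel_ses.
Qed.

Lemma ses_id_r A Z : is_zero Z -> short_exact (idm A) (0 : hom A Z).
Proof.
move=> hZ; apply: sesI; [exact: mono_idm | | exact: comp0m |].
  by move=> T u v _; rewrite ((hZ T).1 u) ((hZ T).1 v).
by move=> T x _; exists T, (idm T), x; split; [exact: epi_idm | rewrite comp1m compm1].
Qed.

Lemma ses_id_l A Z : is_zero Z -> short_exact (0 : hom Z A) (idm A).
Proof.
move=> hZ; apply: sesI; [| exact: epi_idm | exact: compm0 |].
  by move=> T u v _; rewrite ((hZ T).2 u) ((hZ T).2 v).
move=> T x; rewrite comp1m => ->.
by exists T, (idm T), 0; split; [exact: epi_idm | rewrite !comp0m].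
Qed.

Lemma is_iso_mono_epi A B (f : hom A B) : is_iso f -> is_mono f /\ is_epi f.
Proof.
move=> [g [gf fg]]; split=> T u v e.
  by rewrite -[u]comp1m -gf -compA e compA gf comp1m.
by rewrite -[u]compm1 -fg compA e -compA fg compm1.
Qed.

Lemma ses_iso_r A B D D' (f : hom A B) (g : hom B D) (h : hom D D') :
  short_exact f g -> is_iso h -> short_exact f (h \oc g).
Proof.
move=> s ih; have [mf ex eg] := s; have [mh eh] := is_iso_mono_epi ih.
apply: sesI => //; [exact: epi_comp | by rewrite -compA (ses0 s) compm0 |].
move=> T x; rewrite -compA => /((monoP h).1 mh) gx0; exact: exact_lift ex gx0.
Qed.

Lemma ses_iso_l A A' B D (f : hom A B) (g : hom B D) (h : hom A' A) :
  short_exact f g -> is_iso h -> short_exact (f \oc h) g.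
Proof.
move=> s [h' [h'h hh']]; have [mf ex eg] := s.
have [mh eh] := @is_iso_mono_epi _ _ h (ex_intro _ h' (conj h'h hh')).
apply: sesI => //; [exact: mono_comp | by rewrite compA (ses0 s) comp0m |].
move=> T x /(ses_lift s)[y fy]; exists T, (idm T), (h' \oc y).
by split; [exact: epi_idm | rewrite -compA (compA h) hh' comp1m fy compm1].
Qed.

End ShortExact.

Section ShortExactDual.
Local Open Scope ring_scope.
Context {C : abelianCat}.
Implicit Types A B D G K L M N Q T U X Y Z : C.

Lemma ses_desc A B D (f : hom A B) (g : hom B D) T (x : hom B T) :
  short_exact f g -> x \oc f = 0 -> exists y : hom D T, y \oc g = x.
Proof. by move=> /short_exact_op/(@ses_lift (op C)); apply. Qed.

Lemma ses_of_mono A B (f : hom A B) :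
  is_mono f -> exists D (g : hom B D), short_exact f g.
Proof.
move=> mf; have [D [g s]] := @ses_of_epi (op C) B A f mf.
by exists D, g; apply/short_exact_op.
Qed.

Lemma cokernel_epi A B Q (f : hom A B) (q : hom B Q) : is_cokernel f q -> is_epi q.
Proof. exact: (@kernel_mono (op C) B A Q f q). Qed.

Lemma cokernel_exact A B Q (f : hom A B) (q : hom B Q) : is_cokernel f q -> exact f q.
Proof.
move=> kq; apply/exact_op; exists Q, q, (idm Q).
by split; [exact: kq | exact: (@epi_idm (op C)) | exact: esym (@comp1m C _ _ q)].
Qed.

Lemma exact_desc A B D T (f : hom A B) (g : hom B D) (x : hom B T) :
  exact f g -> is_epi g -> x \oc f = 0 -> exists y, y \oc g = x.
Proof.
move=> ex eg xf0; have [K [k s]] := ses_of_epi eg.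
apply: (ses_desc s).
have [T' [p [a [ep fa]]]] := exact_lift ex (ses0 s).
by apply: ((epiP p).1 ep); rewrite -compA -fa compA xf0 comp0m.
Qed.

(** * Pullbacks, composites and the horseshoe *)

(** The last clause is the symmetric statement for the same pullback square; the
    two together say that P is an extension of Y by A and of X by D. *)
Lemma ses_pullback A X M Y (a : hom A X) (b : hom X M) (d : hom Y M) :
  short_exact a b ->
  exists P (p : hom P X) (q : hom P Y) (i : hom A P),
    [/\ b \oc p = d \oc q, short_exact i q, p \oc i = a &
      forall D (c : hom D Y), short_exact c d ->
        exists j : hom D P, [/\ short_exact j p, q \oc j = c & p \oc j = 0]].
Proof.
move=> s; have [P [p [q [e lft jm pbe]]]] := pullback b d.
have [ma ex eb] := s.
have [i [pi qi]] : exists i : hom A P, p \oc i = a /\ q \oc i = 0.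
  by apply: lft; rewrite (ses0 s) compm0.
exists P, p, q, i; split=> //.
  apply: sesI => //; [| exact: pbe |].
    by move=> T u v euv; apply: ma; rewrite -pi -!compA euv.
  move=> T x qx0.
  have [y ay] : exists y, a \oc y = p \oc x.
    by apply: (ses_lift s); rewrite compA e -compA qx0 compm0.
  exists T, (idm T), y; split; first exact: epi_idm.
  rewrite compm1; apply/subr0_eq/jm; rewrite compmB compA ?pi ?qi ?ay ?subrr //.
  by rewrite comp0m qx0 subrr.
move=> D c s'; have [mc ex' ed] := s'.
have [j [pj qj]] : exists j : hom D P, p \oc j = 0 /\ q \oc j = c.
  by apply: lft; rewrite (ses0 s') compm0.
exists j; split=> //; apply: sesI => //.
- by move=> T u v euv; apply: mc; rewrite -qj -!compA euv.
- apply: epiI => T x; have [T' [r [y [er dy]]]] := epi_lift (b \oc x) ed.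
  have [w [pw qw]] : exists w : hom T' P, p \oc w = x \oc r /\ q \oc w = y.
    by apply: lft; rewrite dy compA.
  by exists T', r, w.
move=> T x px0.
have [y cy] : exists y, c \oc y = q \oc x.
  by apply: (ses_lift s'); rewrite compA -e -compA px0 compm0.
exists T, (idm T), y; split; first exact: epi_idm.
rewrite compm1; apply/subr0_eq/jm; rewrite compmB compA ?pj ?qj ?cy ?subrr //.
by rewrite comp0m px0 subrr.
Qed.

(** Third isomorphism theorem: the kernel of a composite of two epimorphisms is an
    extension of the kernels. *)
Lemma ses_comp_epi K X Y A Z (k : hom K X) (p : hom X Y) (f : hom A Y) (g : hom Y Z) :
  short_exact k p -> short_exact f g ->
  exists N (n : hom N X) (l : hom K N) (m : hom N A),
    [/\ short_exact n (g \oc p), short_exact l m, n \oc l = k & p \oc n = f \oc m].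
Proof.
move=> s s'.
have [N [m [n [l [e sl nl h]]]]] := ses_pullback f s.
have [_ _ ep] := s; have [mf ex eg] := s'.
have [_ _ en] := sl.
exists N, m, l, n; split=> //.
apply: sesI.
- apply/monoP => T x mx0.
  have nx0 : n \oc x = 0.
    by apply: ((monoP f).1 mf); rewrite compA -e -compA mx0 compm0.
  have [y ly] := ses_lift sl nx0.
  have [mk _ _] := s; rewrite -ly; suff -> : y = 0 by rewrite compm0.
  by apply: ((monoP k).1 mk); rewrite -nl -compA ly.
- exact: epi_comp.
- by rewrite -compA e compA (ses0 s') comp0m.
move=> T x; rewrite -compA => /(ses_lift s')[y fy].
have [T' [q [z [eq nz]]]] := epi_lift y en.
have [w kw] : exists w, k \oc w = x \oc q - m \oc z.
  by apply: (ses_lift s); rewrite compmB !compA e -(compA f) nz compA fy subrr.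
exists T', q, (l \oc w + z); split=> //.
by rewrite compDr compA nl kw subrK.
Qed.

(** Only the left vertical map has to be extended to the middle object ([t]); the
    new middle term is U1 (+) U2, presented as an extension since that is how the
    classes in which it must lie are closed. *)
Lemma horseshoe G L K U1 G2 U2 K2 (i : hom G L) (k : hom L K) (a : hom G U1)
    (b : hom U1 G2) (c : hom K U2) (d : hom U2 K2) (t : hom L U1) :
  short_exact i k -> short_exact a b -> short_exact c d -> t \oc i = a ->
  exists E N,
    [/\ exists (e : hom L E) (p : hom E N), short_exact e p,
        exists (m : hom G2 N) (n : hom N K2), short_exact m n
      & exists (u : hom U1 E) (v : hom E U2), short_exact u v].
Proof.
move=> si sa sc ti; have [mi _ ek] := si; have [ma _ eb] := sa; have [mc _ ed] := sc.
pose e := pairm t (c \oc k).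
have me : is_mono e.
  apply/monoP => T x; rewrite pair_comp -pair0 => /pair_inj[tx0].
  rewrite -compA => /((monoP c).1 mc)/(ses_lift si)[y iy].
  rewrite -iy; suff -> : y = 0 by rewrite compm0.
  by apply: ((monoP a).1 ma); rewrite -ti -compA iy.
have [N [p sp]] := ses_of_mono me; have [_ _ ep] := sp.
exists (bip U1 U2 : C), N; split; first by exists e, p.
  have [m mb] : exists m : hom G2 N, m \oc b = p \oc in1 _.
    apply: (ses_desc sa); rewrite -compA.
    have -> : in1 _ \oc a = e \oc i.
      rewrite pair_comp ti -compA (ses0 si) compm0.
      by rewrite /pairm compm0 addr0.
    by rewrite compA (ses0 sp) comp0m.
  have [n np] : exists n : hom N K2, n \oc p = d \oc pr2 _.
    by apply: (ses_desc sp); rewrite -compA pr2_pair compA (ses0 sc) comp0m.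
  exists m, n; apply: sesI.
  - apply/monoP => T y my0; have [T' [q [u [eq bu]]]] := epi_lift y eb.
    (* an element of U1 that dies in N lies in L, and then in the kernel G of [k] *)
    have [l el] : exists l, e \oc l = in1 _ \oc u.
      by apply: (ses_lift sp); rewrite compA -mb -compA bu compA my0 comp0m.
    have tl : t \oc l = u.
      by rewrite -(pr1_pair t (c \oc k)) -compA el compA pr1_in1 comp1m.
    have /((monoP c).1 mc)/(ses_lift si)[g ig] : c \oc (k \oc l) = 0.
      by rewrite compA -(pr2_pair t (c \oc k)) -compA el compA pr2_in1 comp0m.
    apply: ((epiP q).1 eq).
    by rewrite -bu -tl -ig (compA t) ti compA (ses0 sa) comp0m.
  - apply: (@epi_compl _ _ _ _ _ p); rewrite np; apply: epi_comp => //.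
    by apply: (@epi_compl _ _ _ _ _ (in2 _)); rewrite pr2_in2; apply: epi_idm.
  - by apply/eb; rewrite -compA mb compA np -compA pr2_in1 compm0 comp0m.
  move=> T x nx0; have [T1 [q1 [w [eq1 pw]]]] := epi_lift x ep.
  have [z cz] : exists z, c \oc z = pr2 _ \oc w.
    by apply: (ses_lift sc); rewrite compA -np -compA pw compA nx0 comp0m.
  have [T2 [q2 [l [eq2 kl]]]] := epi_lift z ek.
  exists T2, (q1 \oc q2), (b \oc (pr1 _ \oc w \oc q2 - t \oc l)).
  split; first exact: epi_comp.
  have wE : w \oc q2 = in1 _ \oc (pr1 _ \oc w \oc q2 - t \oc l) + e \oc l.
    rewrite {1}(pair_eta (w \oc q2)) (compA (pr2 _)) -cz -!compA -kl.
    by rewrite pair_comp compmB -compA /pairm addrA subrK.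
  rewrite compA mb [RHS]compA -pw -(compA p w) wE (compDr p) (compA p e).
  by rewrite (ses0 sp) comp0m addr0 compA.
exists (in1 _), (pr2 _); apply: sesI.
- apply/monoP => T x h.
  by rewrite -[x]comp1m -(pr1_in1 (bip U1 U2)) -compA h compm0.
- by apply: (@epi_compl _ _ _ _ _ (in2 _)); rewrite pr2_in2; apply: epi_idm.
- exact: pr2_in1.
move=> T x h; exists T, (idm T), (pr1 _ \oc x); split; first exact: epi_idm.
by rewrite compm1 {2}(pair_eta x) h /pairm compm0 addr0.
Qed.

End ShortExactDual.

Section PullbackDual.
Local Open Scope ring_scope.
Context {C : abelianCat}.
Implicit Types A B D G K L M N Q T U X Y Z : C.

Lemma ses_pushout A X M Y D (a : hom X A) (b : hom M X) (d : hom M Y) (c : hom Y D) :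
  short_exact b a -> short_exact d c ->
  exists P (p : hom X P) (q : hom Y P) (i : hom P A) (j : hom P D),
    [/\ short_exact q i, short_exact p j & p \oc b = q \oc d].
Proof.
move=> s s'.
have [P [p [q [i [e sq _ h]]]]] := @ses_pullback (op C) A X M Y a b d ((short_exact_op b a).1 s).
have [j [sp _ _]] := h D c ((short_exact_op d c).1 s').
exists P, p, q, i, j; split=> //; apply/short_exact_op => //.
Qed.

Lemma ses_comp_mono L L0 M U A (f : hom L L0) (g : hom L0 M) (h : hom L0 U) (k : hom U A) :
  short_exact f g -> short_exact h k ->
  exists N (n : hom U N) (l : hom M N) (m : hom N A),
    short_exact (h \oc f) n /\ short_exact l m.
Proof.
move=> s s'.
have [N [n [m [l [s1 s2 _ _]]]]] := @ses_comp_epi (op C) A U L0 M L k h g f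
  ((short_exact_op h k).1 s') ((short_exact_op f g).1 s).
by exists N, n, l, m; split; apply/short_exact_op.
Qed.

Lemma horseshoe_op G L K U1 G2 U2 K2 (i : hom L G) (k : hom K L) (a : hom U1 G)
    (b : hom G2 U1) (c : hom U2 K) (d : hom K2 U2) (t : hom U1 L) :
  short_exact k i -> short_exact b a -> short_exact d c -> i \oc t = a ->
  exists E N,
    [/\ exists (e : hom E L) (p : hom N E), short_exact p e,
        exists (m : hom N G2) (n : hom K2 N), short_exact n m
      & exists (u : hom E U1) (v : hom U2 E), short_exact v u].
Proof.
move=> s1 s2 s3 e.
have [E [N [[x1 [x2 t1]] [y1 [y2 t2]] [z1 [z2 t3]]]]] :=
  @horseshoe (op C) G L K U1 G2 U2 K2 i k a b c d t
   ((short_exact_op k i).1 s1) ((short_exact_op b a).1 s2) ((short_exact_op d c).1 s3) e.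
exists E, N; split.
- by exists x1, x2; apply/short_exact_op.
- by exists y1, y2; apply/short_exact_op.
- by exists z1, z2; apply/short_exact_op.
Qed.

End PullbackDual.

(** * Vanishing of Ext^1 as splitting *)

Section Split.
Local Open Scope ring_scope.
Context {C : abelianCat}.
Implicit Types A B D G K L M N Q T U X Y Z : C.

(** Vanishing of Ext^1(M, T), in the form in which it is used; for this form all
    that is needed about Ext^1 is elementary, and it is self-dual. *)
Definition ext_splits M T : Prop :=
  forall X (u : hom T X) (v : hom X M), short_exact u v -> exists s, v \oc s = idm M.

Lemma section_retraction M T X (u : hom T X) (v : hom X M) : short_exact u v ->
  (exists s, v \oc s = idm M) <-> (exists r, r \oc u = idm T).
Proof.
move=> su; have [mu _ ev] := su; split=> [[s vs]|[r ru]].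
  have [|r ur] := @ses_lift _ _ _ _ u v _ (idm X - s \oc v) su.
    by rewrite compmB compm1 compA vs comp1m subrr.
  by exists r; apply: mu; rewrite compA ur compBm -compA (ses0 su) compm0 subr0 comp1m compm1.
have [|s sv] := @ses_desc _ _ _ _ u v _ (idm X - u \oc r) su.
  by rewrite compBm comp1m -compA ru compm1 subrr.
by exists s; apply: ev; rewrite -compA sv compmB compA (ses0 su) comp0m subr0 comp1m compm1.
Qed.

Lemma ext_splits_lift A B D T (f : hom A B) (g : hom B D) (h : hom T D) :
  short_exact f g -> ext_splits T A -> exists h', g \oc h' = h.
Proof.
move=> s sT; have [P [p [q [i [e si _ _]]]]] := ses_pullback h s.
by have [t qt] := sT _ _ _ si; exists (p \oc t); rewrite compA e -compA qt compm1.
Qed.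

(** The segment Hom(U, T) -> Hom(L, T) -> Ext^1(M, T) -> Ext^1(U, T) of the long
    exact sequence. *)
Lemma ext_splits_quot L U M T (f : hom L U) (g : hom U M) :
  short_exact f g -> ext_splits U T -> (forall h : hom L T, exists h', h' \oc f = h) ->
  ext_splits M T.
Proof.
move=> s sU ext X u v su; have [p vp] := ext_splits_lift g su sU.
have [|h uh] := @ses_lift _ _ _ _ u v _ (p \oc f) su.
  by rewrite compA vp (ses0 s).
have [h' hf] := ext h.
have [|t tg] := @ses_desc _ _ _ _ f g _ (p - u \oc h') s.
  by rewrite compBm -compA hf uh subrr.
exists t; have [_ _ eg] := s; apply: eg.
by rewrite -compA tg compmB vp compA (ses0 su) comp0m subr0 comp1m.
Qed.

End Split.

Section SplitDual.
Local Open Scope ring_scope.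
Context {C : abelianCat}.
Implicit Types A B D G K L M N Q T U X Y Z : C.

Lemma ext_splits_op M T : ext_splits M T <-> @ext_splits (op C) T M.
Proof.
split=> h X u v s.
  have s' := (@short_exact_op C T X M v u).2 s.
  exact: (section_retraction s').1 (h _ _ _ s').
apply/(section_retraction s); exact: h ((short_exact_op u v).1 s).
Qed.

Lemma ext_splits_extend A B D T (f : hom A B) (g : hom B D) (h : hom A T) :
  short_exact f g -> ext_splits D T -> exists h', h' \oc f = h.
Proof.
by move=> /short_exact_op s /ext_splits_op; apply: (@ext_splits_lift (op C) _ _ _ _ _ _ h s).
Qed.

Lemma ext_splits_sub K U L T (f : hom K U) (g : hom U L) :
  short_exact f g -> ext_splits T U -> (forall h : hom T L, exists h', g \oc h' = h) ->
  ext_splits T K.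
Proof.
move=> /short_exact_op s /ext_splits_op sU h; apply/ext_splits_op.
exact: (@ext_splits_quot (op C) _ _ _ _ _ _ s).
Qed.

(** Half-exactness of Ext^1(-, T): the retraction onto T is built on the preimage
    of A, where it exists since Ext^1(A, T) = 0, and then extended because
    Ext^1(D, T) = 0. *)
Lemma ext_splits_mid_l A B D T (f : hom A B) (g : hom B D) :
  short_exact f g -> ext_splits A T -> ext_splits D T -> ext_splits B T.
Proof.
move=> s sA sD X u v su.
have [N [n [l [m [sn sl nl _]]]]] := ses_comp_epi su s.
have [r rl] := (section_retraction sl).1 (sA _ _ _ sl).
have [r' r'n] := ext_splits_extend r sn sD.
by apply/(section_retraction su); exists r'; rewrite -nl compA r'n.
Qed.

End SplitDual.

Lemma ext_splits_mid_r (C : abelianCat) (A B D T : C) (f : hom A B) (g : hom B D) :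
  short_exact f g -> ext_splits T A -> ext_splits T D -> ext_splits T B.
Proof.
move=> /short_exact_op s /ext_splits_op sA /ext_splits_op sD; apply/ext_splits_op.
exact: (@ext_splits_mid_l (op C) _ _ _ _ _ _ s).
Qed.

(** * Resolutions and their morphisms *)

Section Resolutions.
Local Open Scope ring_scope.
Context {C : abelianCat}.
Implicit Types A D K M N Q T X Y Z : C.

Record resol M := Resol {
  ro :> nat -> C;
  rd : forall k, hom (ro k.+1) (ro k);
  re : hom (ro 0) M;
  resolP : is_resolution rd re
}.

Definition rmap M N (a : hom M N) (P : resol M) (Q : resol N)
    (c : forall k, hom (P k) (Q k)) : Prop :=
  (forall k, c k \oc rd P k = rd Q k \oc c k.+1) /\ re Q \oc c 0%N = a \oc re P.

Section Facts.
Variables (M : C) (P : resol M).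

Lemma re_epi : is_epi (re P). Proof. by have [] := resolP P. Qed.

Lemma re_rd : re P \oc rd P 0 = 0.
Proof. by have [_ /exact0] := resolP P. Qed.

Lemma rd_rd k : rd P k \oc rd P k.+1 = 0.
Proof. by have [_ _ /(_ k)/exact0] := resolP P. Qed.

Lemma re_lift T (x : hom T (P 0)) : re P \oc x = 0 ->
  exists T' (q : hom T' T) (a : hom T' (P 1)), is_epi q /\ rd P 0 \oc a = x \oc q.
Proof. by have [_ ex _] := resolP P; apply: exact_lift. Qed.

Lemma rd_lift k T (x : hom T (P k.+1)) : rd P k \oc x = 0 ->
  exists T' (q : hom T' T) (a : hom T' (P k.+2)), is_epi q /\ rd P k.+1 \oc a = x \oc q.
Proof. by have [_ _ ex] := resolP P; apply: exact_lift. Qed.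

End Facts.

Lemma rmap_comp M N L (a : hom M N) (b : hom N L) (P : resol M) (Q : resol N) (R : resol L)
    (c : forall k, hom (P k) (Q k)) (c' : forall k, hom (Q k) (R k)) :
  rmap a c -> rmap b c' -> rmap (b \oc a) (fun k => c' k \oc c k).
Proof.
move=> [h1 h2] [h1' h2']; split=> [k|]; first by rewrite -compA h1 !compA h1'.
by rewrite compA h2' -!compA h2.
Qed.

Lemma rmap_comp_id M N (a : hom M N) (P P' : resol M) (Q : resol N)
    (c : forall k, hom (P' k) (P k)) (c' : forall k, hom (P k) (Q k)) :
  rmap (idm M) c -> rmap a c' -> rmap a (fun k => c' k \oc c k).
Proof. by rewrite -{2}[a]compm1; apply: rmap_comp. Qed.

Lemma rmapE M N (a : hom M N) (P : resol M) (Q : resol N) (c : forall k, hom (P k) (Q k)) :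
  rmap a c ->
  (forall k T (x : hom T (P k.+1)), c k \oc (rd P k \oc x) = rd Q k \oc (c k.+1 \oc x)) /\
  (forall T (x : hom T (P 0)), re Q \oc (c 0 \oc x) = a \oc (re P \oc x)).
Proof. by move=> [h1 h2]; split=> *; rewrite !compA ?h1 ?h2. Qed.

(** Resolutions are built and taken apart at their augmented end; this keeps all
    indices definitional, and inductions on the degree pass to the first syzygy. *)
Definition cons_obj X (P : nat -> C) (k : nat) : C :=
  match k with 0 => X | S k => P k end.

Definition cons_d X (P : nat -> C) (d : forall k, hom (P k.+1) (P k))
    (x : hom (P 0) X) (k : nat) : hom (cons_obj X P k.+1) (cons_obj X P k) :=
  match k with 0 => x | S k => d k end.

Lemma cons_resolution K X Z (f : hom K X) (g : hom X Z) P
    (d : forall k, hom (P k.+1) (P k)) (e : hom (P 0) K) :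
  short_exact f g -> is_resolution d e -> is_resolution (cons_d d (f \oc e)) g.
Proof.
move=> s [ee ex0 exS]; have [mf _ eg] := s; split=> //.
  apply: exactI; first by rewrite compA (ses0 s) comp0m.
  move=> T x /(ses_lift s)[y fy]; have [T' [q [a [eq ea]]]] := epi_lift y ee.
  by exists T', q, a; split; rewrite // -compA ea compA fy.
case=> [|k]; last exact: exS.
apply: exactI; first by rewrite -compA (exact0 ex0) compm0.
by move=> T x; rewrite -compA => /((monoP f).1 mf)/(exact_lift ex0).
Qed.

Definition resol_cons K X Z (f : hom K X) (g : hom X Z) (s : short_exact f g)
  (P : resol K) : resol Z := Resol (cons_resolution s (resolP P)).

Lemma resolution_tail Z (P : nat -> C) (d : forall k, hom (P k.+1) (P k)) (e : hom (P 0) Z) :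
  is_resolution d e ->
  exists K (f : hom K (P 0)) (e' : hom (P 1) K),
    [/\ short_exact f e, f \oc e' = d 0%N & is_resolution (fun k => d k.+1) e'].
Proof.
move=> [ee ex0 exS]; have [K [f s]] := ses_of_epi ee; have [mf _ _] := s.
have [e' fe] := ses_lift s (exact0 ex0).
exists K, f, e'; split=> //; split=> [||k]; last exact: exS.
  apply: epiI => T x.
  have [|T' [q [a [eq da]]]] := @exact_lift _ _ _ _ _ _ _ (f \oc x) ex0.
    by rewrite compA (ses0 s) comp0m.
  by exists T', q, a; split=> //; apply: mf; rewrite !compA fe.
apply: exactI; first by apply: ((monoP f).1 mf); rewrite compA fe (exact0 (exS 0%N)).
move=> T x ex; apply: (exact_lift (exS 0%N)).
by rewrite -fe -compA ex compm0.
Qed.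

Lemma resol_tail Z (P : resol Z) :
  exists K (f : hom K (P 0)) (e : hom (P 1) K) (h : is_resolution (fun k => rd P k.+1) e),
    short_exact f (re P) /\ f \oc e = rd P 0%N.
Proof. by have [K [f [e [? ? h]]]] := resolution_tail (resolP P); exists K, f, e, h. Qed.

(** A morphism of first syzygies together with a map in degree 0 is a morphism of
    resolutions. The tail of the target is given separately because
    [P] is only isomorphic to the resolution rebuilt from its tail. *)
Lemma rmap_into_tail Z Z' K K' X (z : hom Z' Z) (P : resol Z) (f : hom K (P 0))
    (e : hom (P 1) K) (hT : is_resolution (fun k => rd P k.+1) e)
    (f' : hom K' X) (g' : hom X Z') (s' : short_exact f' g') (P' : resol K')
    (h : hom K' K) (x : hom X (P 0)) (c : forall k, hom (P' k) (P k.+1)) :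
  f \oc e = rd P 0%N -> @rmap _ _ h P' (Resol hT) c ->
  f \oc h = x \oc f' -> re P \oc x = z \oc g' ->
  exists c' : forall k, hom (resol_cons s' P' k) (P k),
    [/\ rmap z c', c' 0%N = x & forall k, c' k.+1 = c k].
Proof.
move=> fe [h1 h2] fh ex.
exists (fun k => match k return hom (resol_cons s' P' k) (P k) with
                 0 => x | S k => c k end); split=> //; split=> //.
case=> [|k]; last exact: h1.
by rewrite /= compA -fh -compA -h2 compA fe.
Qed.

(** Only degree 0 has to change: pulling P_0 -> K back along [h] leaves the kernel,
    and hence the rest of the resolution, as it was. *)
Lemma resol_base_change K K' (h : hom K' K) (P : resol K) :
  exists (P' : resol K') c, @rmap _ _ h P' P c.
Proof.
have [K1 [f [e [hT [s fe]]]]] := resol_tail P.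
have [Y [p [q [i [epq s' pi _]]]]] := ses_pullback h s.
have [||c [hc _ _]] := @rmap_into_tail _ _ _ _ _ h P f e hT _ _ s' (Resol hT) (idm _) p
  (fun k => idm _) fe _ _ epq.
- by split=> [k|] /=; rewrite ?comp1m ?compm1.
- by rewrite compm1 pi.
by exists (resol_cons s' (Resol hT)), c.
Qed.

(** In degree 0 one may replace P_0 by any cover of it, at the price of a base
    change of the first syzygy; higher degrees reduce to this by taking syzygies. *)
Lemma resol_refine n Z (P : resol Z) Y (q : hom Y (P n)) : is_epi q ->
  exists (P' : resol Z) c, @rmap _ _ (idm Z) P' P c /\
    exists l : hom (P' n) Y, q \oc l = c n.
Proof.
elim: n Z P Y q => [|n IH] Z P Y q eq.
  have [K [f [e [hT [s fe]]]]] := resol_tail P.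
  have [K' [f' s']] := ses_of_epi (epi_comp eq (@re_epi _ P)).
  have [h fh] : exists h, f \oc h = q \oc f'.
    by apply: (ses_lift s); rewrite compA (ses0 s').
  have [P' [c hc]] := resol_base_change h (Resol hT).
  have [|c' [hc' c0 _]] := @rmap_into_tail _ _ _ _ _ (idm Z) P f e hT _ _ s' P' h q c fe hc fh.
    by rewrite comp1m.
  exists (resol_cons s' P'), c'; split=> //.
  by exists (idm _); rewrite c0 compm1.
have [K [f [e [hT [s fe]]]]] := resol_tail P.
have [P' [c [hc [l ql]]]] := IH K (Resol hT) Y q eq.
have [||c' [hc' _ cS]] :=
  @rmap_into_tail _ _ _ _ _ (idm Z) P f e hT _ _ s P' (idm K) (idm _) c fe hc.
- by rewrite compm1 comp1m.
- by rewrite comp1m compm1.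
by exists (resol_cons s P'), c'; split=> //; exists l; rewrite cS.
Qed.

Definition zeroC : C := sval (cid (abelian_zero C)).
Lemma zeroCP : is_zero zeroC. Proof. exact: svalP (cid (abelian_zero C)). Qed.

Lemma resolution_zero Z : is_zero Z ->
  @is_resolution C Z (fun=> zeroC) (fun=> 0) 0.
Proof.
move=> hZ; have e0 X (f : hom zeroC X) : f = 0 by exact: (zeroCP X).1.
have ex A (f : hom zeroC zeroC) (g : hom zeroC A) : exact f g.
  apply: exactI => [|T x _]; first by rewrite [g]e0 comp0m.
  exists T, (idm T), x; split; first exact: epi_idm.
  by rewrite ((zeroCP T).2 (_ \oc _)) ((zeroCP T).2 (x \oc _)).
split=> // T u v _; by rewrite ((hZ T).1 u) ((hZ T).1 v).
Qed.

Definition resol_self M : resol M :=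
  Resol (cons_resolution (ses_id_l M zeroCP) (resolution_zero zeroCP)).

End Resolutions.

(** * The homotopy pullback of resolutions *)

(** Given [phi : P -> F] and [psi : Q -> F], the homotopy pullback has the terms
    P_k (+) Q_k (+) F_(k+1), the last component being a homotopy between the images
    of the first two. [hdef] measures how far a triple is from being such a
    homotopy, and degree 0 of the resolution is the kernel of [hdef 0]. Contrary to
    the degreewise pullback, this is exact for any [phi] and [psi]. *)
Section HomotopyPullback.
Local Open Scope ring_scope.
Context {C : abelianCat}.
Implicit Types A B D K M N Q T X Y Z : C.

Definition tri A B D : C := bip (bip A B) D.
Definition trip A B D T (u : hom T A) (v : hom T B) (w : hom T D) : hom T (tri A B D) :=
  pairm (pairm u v) w.
(** The projections are locked so that rewriting with associativity does not look
    inside them. *)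
Definition t1 A B D : hom (tri A B D) A := locked (pr1 _ \oc pr1 _).
Definition t2 A B D : hom (tri A B D) B := locked (pr2 _ \oc pr1 _).
Definition t3 A B D : hom (tri A B D) D := pr2 _.
Arguments t1 {A B D}. Arguments t2 {A B D}. Arguments t3 {A B D}.

Lemma t1_trip A B D T (u : hom T A) (v : hom T B) (w : hom T D) : t1 \oc trip u v w = u.
Proof. by rewrite /t1 -lock -compA !pr1_pair. Qed.
Lemma t2_trip A B D T (u : hom T A) (v : hom T B) (w : hom T D) : t2 \oc trip u v w = v.
Proof. by rewrite /t2 -lock -compA pr1_pair pr2_pair. Qed.
Lemma t3_trip A B D T (u : hom T A) (v : hom T B) (w : hom T D) : t3 \oc trip u v w = w.
Proof. by rewrite pr2_pair. Qed.
Definition tripE := (t1_trip, t2_trip, t3_trip).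

Lemma trip_ext A B D T (x y : hom T (tri A B D)) :
  t1 \oc x = t1 \oc y -> t2 \oc x = t2 \oc y -> t3 \oc x = t3 \oc y -> x = y.
Proof.
rewrite /t1 /t2 /t3 -!lock -!compA => e1 e2 e3.
by rewrite (pair_eta x) (pair_eta y) (pair_eta (pr1 _ \oc x)) (pair_eta (pr1 _ \oc y)) e1 e2 e3.
Qed.

Variables (A D : C) (a : hom A D) (P : resol A) (F Q : resol D).
Variables (phi : forall k, hom (P k) (F k)) (psi : forall k, hom (Q k) (F k)).
Hypotheses (hphi : rmap a phi) (hpsi : rmap (idm D) psi).

Let dphi := (rmapE hphi).1.
Let ephi := (rmapE hphi).2.
Let dpsi := (rmapE hpsi).1.
Let epsi := (rmapE hpsi).2.
Let rr k T (x : hom T (F k.+2)) : rd F k \oc (rd F k.+1 \oc x) = 0.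
Proof. by rewrite compA rd_rd comp0m. Qed.

Definition hdef k : hom (tri (P k) (Q k) (F k.+1)) (F k) :=
  phi k \oc t1 - psi k \oc t2 - rd F k \oc t3.

Lemma hdefE k T (x : hom T (tri (P k) (Q k) (F k.+1))) :
  hdef k \oc x = phi k \oc (t1 \oc x) - psi k \oc (t2 \oc x) - rd F k \oc (t3 \oc x).
Proof. by rewrite !compBm -!compA. Qed.

Definition hdiff k : hom (tri (P k.+1) (Q k.+1) (F k.+2)) (tri (P k) (Q k) (F k.+1)) :=
  trip (rd P k \oc t1) (rd Q k \oc t2) (hdef k.+1).

Lemma hdef_hdiff k : hdef k \oc hdiff k = 0.
Proof. by rewrite hdefE !tripE dphi dpsi /hdef !compmB rr subr0 subrr. Qed.

Lemma hdiff_lift k T (y : hom T (tri (P k) (Q k) (F k.+1))) T1 (q : hom T1 T)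
    (p : hom T1 (P k.+1)) (b : hom T1 (Q k.+1)) :
  is_epi q -> hdef k \oc y = 0 -> rd P k \oc p = t1 \oc y \oc q ->
  rd Q k \oc b = t2 \oc y \oc q ->
  exists T' (q' : hom T' T) x, is_epi q' /\ hdiff k \oc x = y \oc q'.
Proof.
move=> eq hy dp db.
have d0 : rd F k \oc (phi k.+1 \oc p - psi k.+1 \oc b - t3 \oc y \oc q) = 0.
  rewrite !compmB -dphi -dpsi dp db -!compA.
  by move: (hdefE (y \oc q)); rewrite (compA (hdef k)) hy comp0m => e; rewrite -e.
have [T2 [q2 [u [eq2 du]]]] := rd_lift d0.
exists T2, (q \oc q2), (trip (p \oc q2) (b \oc q2) u); split; first exact: epi_comp.
apply: trip_ext; rewrite [LHS]compA tripE.
- by rewrite -compA tripE compA dp -!compA.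
- by rewrite -compA tripE compA db -!compA.
by rewrite hdefE !tripE du !compBm !compA opprB addrC subrK.
Qed.

Lemma hdiff_exact k T (y : hom T (tri (P k.+1) (Q k.+1) (F k.+2))) :
  hdiff k \oc y = 0 ->
  exists T' (q' : hom T' T) x, is_epi q' /\ hdiff k.+1 \oc x = y \oc q'.
Proof.
move=> hy.
have h1 : rd P k \oc (t1 \oc y) = 0.
  by rewrite compA -(t1_trip (rd P k \oc t1) (rd Q k \oc t2) (hdef k.+1)) -compA hy compm0.
have h2 : rd Q k \oc (t2 \oc y) = 0.
  by rewrite compA -(t2_trip (rd P k \oc t1) (rd Q k \oc t2) (hdef k.+1)) -compA hy compm0.
have h3 : hdef k.+1 \oc y = 0.
  by rewrite -(t3_trip (rd P k \oc t1) (rd Q k \oc t2) (hdef k.+1)) -compA hy compm0.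
have [T1 [q1 [p [eq1 dp]]]] := rd_lift h1.
have [|T2 [q2 [b [eq2 db]]]] := @rd_lift _ _ Q k _ (t2 \oc y \oc q1).
  by rewrite compA h2 comp0m.
apply: (@hdiff_lift _ _ _ _ (q1 \oc q2) (p \oc q2) b) => //.
- exact: epi_comp.
- by rewrite [LHS]compA dp !compA.
- by rewrite db !compA.
Qed.

(** A common refinement of [P] and [Q] over [F]: if [y] becomes a coboundary on [Q],
    it becomes one on the refinement of [P]. Indeed phi - psi equals d u + u d there,
    where u is the third component; [y] kills d u, and y psi is a coboundary. *)
Lemma homotopy_pullback :
  exists (P' : resol A) c, @rmap _ _ _ (idm A) P' P c /\
    forall n T (y : hom (F n.+1) T) (r : hom (Q n) T),
      y \oc rd F n.+1 = 0 -> y \oc psi n.+1 = r \oc rd Q n ->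
      exists r' : hom (P' n) T, y \oc phi n.+1 \oc c n.+1 = r' \oc rd P' n.
Proof.
have [K0 [k kk]] := abelian_kernel (hdef 0).
have mk := kernel_mono kk; have [hk0 uk] := kk.
have klift T (x : hom T (tri (P 0) (Q 0) (F 1))) : hdef 0 \oc x = 0 -> exists y, k \oc y = x.
  by move=> /uk[y [ky _]]; exists y.
have [dl kdl] := klift _ _ (hdef_hdiff 0).
have res : is_resolution (cons_d (fun k => hdiff k.+1) dl) (re P \oc t1 \oc k).
  split.
  - apply: epiI => T x.
    have [T1 [q1 [p [eq1 ep]]]] := epi_lift x (@re_epi _ _ P).
    have [T2 [q2 [b [eq2 eb]]]] := epi_lift (a \oc x \oc q1) (@re_epi _ _ Q).
    have [|T3 [q3 [u [eq3 du]]]] := @re_lift _ _ F _ (phi 0%N \oc p \oc q2 - psi 0%N \oc b).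
      by rewrite compmB epsi comp1m eb -!compA ephi !compA -(compA a) ep !compA subrr.
    have [|w kw] := klift _ (trip (p \oc q2 \oc q3) (b \oc q3) u).
      by rewrite hdefE !tripE du compBm !compA subrr.
    exists T3, (q1 \oc (q2 \oc q3)), w; split; first by do 2![apply: epi_comp => //].
    by rewrite -!compA kw tripE !compA ep.
  - apply: exactI; first by rewrite /= -!compA kdl tripE compA re_rd comp0m.
    move=> T x; rewrite -!compA => ex.
    have hx : hdef 0 \oc (k \oc x) = 0 by rewrite compA hk0 comp0m.
    have [T1 [q1 [p [eq1 dp]]]] := re_lift ex.
    have [|T2 [q2 [b [eq2 db]]]] := @re_lift _ _ Q _ (t2 \oc (k \oc x) \oc q1).
      (* the Q-component is a cycle too, as both components have the same image in D *)
      have := congr1 (fun z => re F \oc z) hx.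
      rewrite hdefE !compmB ephi ex epsi comp1m !compm0 !compA re_rd !comp0m sub0r subr0.
      by move/eqP; rewrite oppr_eq0 => /eqP ->; rewrite comp0m.
    have [||||T3 [q3 [z [eq3 dz]]]] := @hdiff_lift 0 _ (k \oc x) _ (q1 \oc q2) (p \oc q2) b.
    - exact: epi_comp.
    - by [].
    - by rewrite [LHS]compA dp !compA.
    - by rewrite db !compA.
    by exists T3, q3, z; split=> //; apply: mk; rewrite /= compA kdl dz !compA.
  case=> [|n]; apply: exactI => /=.
  - apply: mk; rewrite compA kdl compm0; apply: trip_ext; rewrite !compm0 compA tripE.
    + by rewrite -compA tripE compA rd_rd comp0m.
    + by rewrite -compA tripE compA rd_rd comp0m.
    + exact: hdef_hdiff.
  - by move=> T x dx; apply: hdiff_exact; rewrite -kdl -compA dx compm0.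
  - apply: trip_ext; rewrite !compm0 compA tripE.
    + by rewrite -compA tripE compA rd_rd comp0m.
    + by rewrite -compA tripE compA rd_rd comp0m.
    + exact: hdef_hdiff.
  - by move=> T x dx; apply: hdiff_exact.
pose P' := Resol res.
exists P', (fun n => match n return hom (P' n) (P n) with 0 => t1 \oc k | S n => t1 end).
split.
  split; last by rewrite /= comp1m compA.
  case=> [|n] /=; last by rewrite tripE.
  by rewrite -compA kdl tripE.
move=> n T y r yd yp.
pose s := r \oc t2 + y \oc t3 : hom (tri (P n) (Q n) (F n.+1)) T.
have sd : s \oc hdiff n = y \oc phi n.+1 \oc t1.
  rewrite compDl -!compA !tripE /hdef !compmB !(compA y) yd comp0m subr0.
  by rewrite !compA -yp addrC subrK.
case: n => [|n] in y r {yd yp} s sd *; last by exists s; rewrite /= sd.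
by exists (s \oc k); rewrite /= -[RHS]compA kdl sd.
Qed.

End HomotopyPullback.

(** * Vanishing of Ext, tested on resolutions *)

Section ExtVanish.
Local Open Scope ring_scope.
Context {C : abelianCat}.
Implicit Types A B D K M N Q T X Y Z : C.

(** Ext^(n+1)(M, T) = 0, where Ext is computed as the colimit, over the resolutions
    of M and their refinements, of the cohomology of Hom(-, T). Note the shift of
    the index: [n = 0] is Ext^1. *)
Definition ext_vanish n M T : Prop :=
  forall (P : resol M) (x : hom (P n.+1) T), x \oc rd P n.+1 = 0 ->
    exists (P' : resol M) c, @rmap _ _ _ (idm M) P' P c /\
      exists r : hom (P' n) T, x \oc c n.+1 = r \oc rd P' n.

Definition yext_resol n A B (E : yext n A B) : resol A := Resol (yext_exact E).

(** The class of [E] is the class of the cocycle [c n.+1], for any morphism [c] from a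
    resolution to [E]; so this says that the class is zero. *)
Definition yext_null n A B (E : yext n.+1 A B) : Prop :=
  exists (P : resol A) c, @rmap _ _ _ (idm A) P (yext_resol E) c /\
    exists r : hom (P n) (yext_obj E n.+1), c n.+1 = r \oc rd P n.

(** A refinement killing the class of [E] maps to [F] by composition. Conversely a
    refinement that kills the class of [F] is pulled back along E -> F, which is an
    isomorphism in the top degree. *)
Lemma yext_mor_null n A B (E F : yext n.+1 A B) : yext_mor E F -> yext_null E <-> yext_null F.
Proof.
move=> [f [f1 f2 f3]].
have hf : @rmap _ _ _ (idm A) (yext_resol E) (yext_resol F) f.
  by split=> //; rewrite f2 comp1m.
have [gE [gE1 gE2]] := yext_inj_iso E; have [gF [gF1 gF2]] := yext_inj_iso F.
split=> -[P [c [hc [r cr]]]].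
  exists P, (fun k => f k \oc c k); split.
    exact: rmap_comp_id hc hf.
  by exists (f n.+1 \oc r); rewrite cr compA.
have [P' [c' [hc' h]]] := homotopy_pullback hf hc.
exists P', c'; split=> //.
have z : is_zero (yext_obj F n.+2) by apply: yext_above.
have [||r' hr'] := h n _ (idm _) r.
- by rewrite comp1m; apply: (z _).1.
- by rewrite comp1m.
have e : yext_inj E \oc gF \oc f n.+1 = idm _.
  by rewrite -[LHS]compm1 -gE2 compA -(compA _ _ (yext_inj E)) f3 -(compA _ gF) gF1 compm1.
by exists (yext_inj E \oc gF \oc r'); rewrite -compA -hr' comp1m compA e comp1m.
Qed.

Lemma yext_equiv_null n A B (E F : yext n.+1 A B) :
  yext_equiv E F -> yext_null E <-> yext_null F.
Proof. by elim=> // [? ? /yext_mor_null | ? ? _ -> | ? ? ? _ -> _ ->]. Qed.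

(** The extension that represents the class of the cocycle [x]: the last step of the
    truncated resolution is pushed out along [x]. By passing to syzygies it is enough
    to treat a single short exact sequence. *)
Lemma yext_pushout n Z T (P : resol Z) (x : hom (P n.+1) T) :
  x \oc rd P n.+1 = 0 ->
  exists (E : yext n.+1 Z T) c, @rmap _ _ _ (idm Z) P (yext_resol E) c /\
    c n.+1 = yext_inj E \oc x.
Proof.
elim: n Z P x => [|n IH] Z P x xd.
  (* [Q], the cokernel of [w], is the pushout of [rd P 0] and [x] *)
  pose w := pairm (rd P 0) (- x).
  have [Q [q kq]] := abelian_cokernel w; have [qw uq] := kq.
  have [g [gq _]] : exists! g : hom Q Z, g \oc q = copairm (re P) 0.
    by apply: uq; rewrite copair_pair re_rd comp0m addr0.
  have eq := cokernel_epi kq.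
  have q12 : q \oc in1 _ \oc rd P 0 = q \oc in2 _ \oc x.
    by apply/subr0_eq; rewrite -!compA -compmB -compmN.
  have s : short_exact (q \oc in2 _) g.
    apply: sesI.
    - apply/monoP => U m; rewrite -compA => qm0.
      have [U1 [p [b [ep wb]]]] := exact_lift (cokernel_exact kq) qm0.
      apply: ((epiP p).1 ep).
      have [e1 e2] : rd P 0 \oc b = 0 /\ - x \oc b = m \oc p.
        by apply: pair_inj; rewrite -pair_comp wb -compA /pairm compm0 add0r.
      have [U2 [p2 [c [ep2 dc]]]] := rd_lift e1.
      apply: ((epiP p2).1 ep2).
      by rewrite -e2 compNm -!compNm -compA -dc compA compNm xd oppr0 comp0m.
    - apply: (@epi_compl _ _ _ _ _ (q \oc in1 _)).
      by rewrite compA gq copair_in1; apply: re_epi.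
    - by rewrite compA gq copair_in2.
    move=> U y gy0; have [U1 [p [b [ep qb]]]] := epi_lift y eq.
    have [|U2 [p2 [c [ep2 dc]]]] := @re_lift _ _ P _ (pr1 _ \oc b).
      have : g \oc (q \oc b) = 0 by rewrite qb compA gy0 comp0m.
      by rewrite compA gq (pair_eta b) copair_pair comp0m addr0 pr1_pair.
    exists U2, (p \oc p2), (x \oc c + pr2 _ \oc b \oc p2); split; first exact: epi_comp.
    have bE : b \oc p2 = in1 _ \oc (rd P 0 \oc c) + in2 _ \oc (pr2 _ \oc b \oc p2).
      by rewrite {1}(pair_eta (b \oc p2)) /pairm dc !compA.
    by rewrite compDr [RHS]compA -qb -(compA q b) bE compDr !compA q12.
  pose E0 := resol_cons s (resol_self T).
  have E0z k : (1 < k)%N -> is_zero (E0 k) by case: k => [|[|k]] // _; apply: zeroCP.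
  have iT : is_iso (idm T : hom T (E0 1)) by exists (idm T); rewrite comp1m.
  pose E := Yext (resolP E0) E0z iT.
  exists E, (fun k => match k return hom (P k) (E0 k) with
                      0 => q \oc in1 _ | 1 => x | S (S k) => 0 end).
  split; last by rewrite /= comp1m.
  split; last by rewrite /= comp1m compA gq copair_in1.
  by case=> [|[|k]] /=; rewrite ?compm1 ?q12 ?xd ?comp0m.
have [K [f [e [hT [s fe]]]]] := resol_tail P.
have [E [c [[hc1 hc2] cx]]] := IH K (Resol hT) x xd.
have E1z k : (n.+2 < k)%N -> is_zero (resol_cons s (yext_resol E) k).
  by case: k => // k hk; apply: yext_above.
exists (@Yext _ n.+2 Z T _ _ _ (yext_inj E) (resolP (resol_cons s (yext_resol E)))
  E1z (yext_inj_iso E)).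
exists (fun k => match k return hom (P k) (resol_cons s (yext_resol E) k) with
                 0 => idm _ | S k => c k end); split=> //.
split; last by rewrite /= compm1 comp1m.
case=> [|k] /=; last exact: hc1.
by rewrite comp1m -compA hc2 comp1m fe.
Qed.

(** The extension defined by [x] is connected by a zigzag to the one defined by the
    zero cocycle, so some resolution kills its class; pulling that resolution back
    to [P] makes [x] itself a coboundary. *)
Lemma ext_zero_vanish n M T : Ext_zero n.+1 M T -> ext_vanish n M T.
Proof.
move=> h P x xd.
have [E [c [hc cx]]] := yext_pushout xd.
(* an extension whose class is visibly zero *)
have [|E0 [c0 [hc0 cx0]]] := @yext_pushout n M T P 0; first by rewrite comp0m.
have /(yext_equiv_null (h E0 E)).1 [Q [c' [hc' [r cr]]]] : yext_null E0.
  exists P, c0; split=> //; exists 0.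
  by rewrite cx0 compm0 comp0m.
have [P' [c2 [hc2 hP']]] := homotopy_pullback hc hc'.
have z : is_zero (yext_obj E n.+2) by apply: yext_above.
have [g [g1 g2]] := yext_inj_iso E.
have [||r' hr'] := hP' n _ (idm _) r.
- by rewrite comp1m; apply: (z _).1.
- by rewrite comp1m.
exists P', c2; split=> //; exists (g \oc r').
by rewrite -compA -hr' comp1m cx !compA g1 comp1m.
Qed.

(** A short exact sequence is a resolution of length one, on which the identity of T
    is a cocycle; a cochain bounding it gives the section. *)
Lemma ext_vanish_splits M T : ext_vanish 0 M T -> ext_splits M T.
Proof.
move=> h X u v s; pose P := resol_cons s (resol_self T).
have [|P' [c [[hc1 hc2] [r hr]]]] := h P (idm T); first by rewrite comp1m /= comp0m.
rewrite /= comp1m in hr.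
have hd : (c 0%N - u \oc r) \oc rd P' 0 = 0.
  by rewrite compBm hc1 /= compm1 hr compA subrr.
have [_ ex0 _] := resolP P'.
have [t tE] := exact_desc ex0 (@re_epi _ _ P') hd.
exists t; apply: (@re_epi _ _ P').
by rewrite -compA tE compmB compA (ses0 s) comp0m subr0 hc2 !comp1m.
Qed.

End ExtVanish.

(** * Dimension shifting *)

Section Shift.
Local Open Scope ring_scope.
Context {C : abelianCat}.
Implicit Types A B D K M N Q T W X Y Z : C.

(** The segment Ext^(n+1)(Z, W) -> Ext^(n+1)(Z, K) -> Ext^(n+2)(Z, T) of the long exact
    sequence. A cocycle [x] with values in K is lifted to a cochain [y] in W, after a
    refinement; the coboundary of [y] takes values in T and represents the connecting
    homomorphism. *)
Lemma ext_vanish_shift_r n Z T W K (j : hom T W) (p : hom W K) :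
  short_exact j p -> ext_vanish n.+1 Z T -> ext_vanish n Z W -> ext_vanish n Z K.
Proof.
move=> s vT vW P x xd; have [mj _ ep] := s.
have [Y [a [b [exb sab]]]] : exists Y (a : hom Y W) (b : hom Y (P n.+1)),
    p \oc a = x \oc b /\ is_epi b.
  have [Y [a [b [e _ _ h]]]] := pullback p x; exists Y, a, b; split=> //; exact: h.
have [P1 [c1 [hc1 [l bl]]]] := resol_refine sab.
have [dc1 _] := hc1.
have [y py] : exists y, p \oc y = x \oc c1 n.+1.
  by exists (a \oc l); rewrite compA exb -compA bl.
have [|z jz] := @ses_lift _ _ _ _ _ _ _ (y \oc rd P1 n.+1) s.
  by rewrite compA py -compA dc1 compA xd comp0m.
(* once [z] bounds [r], subtracting [r] from [y] gives a cocycle lifting [x] *)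
have [|P2 [c2 [hc2 [r zr]]]] := vT P1 z.
  by apply: ((monoP j).1 mj); rewrite compA jz -compA rd_rd compm0.
have [dc2 _] := hc2.
have [|P3 [c3 [hc3 [t yt]]]] := vW P2 (y \oc c2 n.+1 - j \oc r).
  by rewrite compBm -!compA dc2 -zr !compA jz subrr.
exists P3, (fun k => c1 k \oc (c2 k \oc c3 k)); split.
  exact: rmap_comp_id (rmap_comp_id hc3 hc2) hc1.
exists (p \oc t); rewrite -(compA p) -yt !compA compmB (compA p j) (ses0 s) comp0m subr0.
by rewrite !compA py.
Qed.

(** The segment Ext^(n+1)(X, T) -> Ext^(n+1)(K, T) -> Ext^(n+2)(Z, T). A cocycle [x] on a
    resolution P of K is one on the resolution ... -> P_0 -> X of Z, one degree higher.
    If R refines the latter and [r] bounds [x] on R, the cone with the terms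
    R_k (+) P_k resolves X, and (r, x) is a cocycle on it that restricts to [x]. *)
Lemma ext_vanish_shift_l n K X Z T (f : hom K X) (g : hom X Z) :
  short_exact f g -> ext_vanish n.+1 Z T -> ext_vanish n X T -> ext_vanish n K T.
Proof.
move=> s vZ vX P x xd; have [mf _ eg] := s.
have [R [c [hc [r xr]]]] := vZ (resol_cons s P) x xd.
have [dc ec] := hc; rewrite /= comp1m in ec.
pose S k : C := bip (R k) (P k).
pose d k : hom (S k.+1) (S k) :=
  pairm (- (rd R k \oc pr1 _)) ((c k.+1 : hom _ (P k)) \oc pr1 _ + rd P k \oc pr2 _).
pose e : hom (S 0) X := copairm (c 0%N) (f \oc re P).
have dE k U (a : hom U (R k.+1)) b :
    d k \oc pairm a b = pairm (- (rd R k \oc a)) ((c k.+1 : hom _ (P k)) \oc a + rd P k \oc b).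
  by rewrite pair_comp compNm compDl -!compA pr1_pair pr2_pair.
have dcS k : (c k.+1 : hom _ (P k)) \oc rd R k.+1 = rd P k \oc (c k.+2 : hom _ (P k.+1)).
  exact: dc k.+1.
have dc0 : c 0%N \oc rd R 0 = f \oc re P \oc (c 1 : hom _ (P 0)) by exact: dc 0%N.
(* to bound a cycle (a, b) of the cone, bound [a] by [a1] and then [b + c a1] *)
have dlift k U (a : hom U (R k)) (b : hom U (P k)) U1 (q : hom U1 U) (a1 : hom U1 (R k.+1)) :
    is_epi q -> rd R k \oc a1 = a \oc q ->
    (exists U2 (q2 : hom U2 U1) b1, is_epi q2 /\
       rd P k \oc b1 = (b \oc q + (c k.+1 : hom _ (P k)) \oc a1) \oc q2) ->
    exists U' (q' : hom U' U) y, is_epi q' /\ d k \oc y = pairm a b \oc q'.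
  move=> eq da [U2 [q2 [b1 [eq2 db]]]].
  exists U2, (q \oc q2), (pairm (- (a1 \oc q2)) b1); split; first exact: epi_comp.
  rewrite dE pair_comp !compmN opprK compA da db compDl addrC !compA.
  by rewrite addrK.
have res : is_resolution d e.
  split.
  - apply: epiI => U y; have [U1 [q1 [a [eq1 ea]]]] := epi_lift (g \oc y) (@re_epi _ _ R).
    have [|k fk] := @ses_lift _ _ _ _ _ _ _ (y \oc q1 - c 0%N \oc a) s.
      by rewrite compmB !compA ec ea subrr.
    have [U2 [q2 [b [eq2 eb]]]] := epi_lift k (@re_epi _ _ P).
    exists U2, (q1 \oc q2), (pairm (a \oc q2) b); split; first exact: epi_comp.
    rewrite copair_pair -compA eb (compA f) fk compBm !compA addrC.
    by rewrite subrK.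
  - apply: exactI.
      rewrite copair_pair compmN compDr !compA dc0 -(compA f (re P) (rd P 0)) re_rd.
      by rewrite compm0 comp0m addr0 addNr.
    move=> U y; rewrite (pair_eta y) copair_pair; move: (pr1 _ \oc y) (pr2 _ \oc y) => a b h.
    have [U1 [q1 [a1 [eq1 da]]]] : exists U1 (q1 : hom U1 U) a1,
        is_epi q1 /\ rd R 0 \oc a1 = a \oc q1.
      apply: re_lift; have := congr1 (fun z => g \oc z) h.
      by rewrite compDr compm0 !compA (ses0 s) !comp0m addr0 ec.
    apply: (dlift _ _ _ _ _ _ _ eq1 da); apply: re_lift; apply: ((monoP f).1 mf).
    rewrite !compDr !compA -dc0 -(compA _ _ a1) da !compA -compDl addrC.
    by rewrite h comp0m.
  move=> k; apply: exactI.
    rewrite dE !compmN !compA rd_rd comp0m !oppr0 compDr !compA rd_rd comp0m addr0 dcS.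
    by rewrite addNr pair0 ?oppr0.
  move=> U y; rewrite (pair_eta y) dE -pair0; move: (pr1 _ \oc y) (pr2 _ \oc y) => a b.
  move=> /pair_inj[/eqP]; rewrite oppr_eq0 => /eqP da0 db0.
  have [U1 [q1 [a1 [eq1 da]]]] := rd_lift da0.
  apply: (dlift _ _ _ _ _ _ _ eq1 da); apply: rd_lift.
  by rewrite compDr !compA -dcS -(compA _ _ a1) da !compA -compDl addrC db0 comp0m.
pose y : hom (S n.+1) T := copairm r x.
have [|S' [c' [hc' [t yt]]]] := vX (Resol res) y.
  rewrite copair_pair compmN compDr !compA xd comp0m addr0 xr.
  by rewrite addNr.
have hi : @rmap _ _ _ f P (Resol res) (fun k => in2 _).
  split=> [k|] /=; last by rewrite copair_in2.
  rewrite pair_comp compNm compDl -!compA pr1_in2 pr2_in2 !compm0 compm1 oppr0 add0r.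
  by rewrite /pairm compm0 add0r.
have [P' [c2 [hc2 h]]] := homotopy_pullback hi hc'.
have [||r' hr'] := h n T y t.
- rewrite copair_pair compmN compDr !compA xd comp0m addr0 xr.
  by rewrite addNr.
- exact: yt.
by exists P', c2; split=> //; exists r'; rewrite -hr' copair_in2.
Qed.

End Shift.

(** * Gorenstein objects as a bisimulation *)

Section Bisimulation.
Local Open Scope ring_scope.
Context {C : abelianCat}.
Implicit Types A D K L M T U Z : C.

(** One short exact sequence of cycles of a complex with terms in A that is
    Hom(-, B)-acyclic; exactness of Hom on the left being automatic, only the
    extension of maps is recorded. *)
Definition half_step (A B : set C) L L' : Prop :=
  exists U (f : hom L U) (g : hom U L'), [/\ short_exact f g, A U &
    forall T, B T -> forall h : hom L T, exists h', h' \oc f = h].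

(** The cycles of all degrees of a complex form a class in which every member has a
    step on either side. Stated like this, without integers, the notion is
    manifestly self-dual. *)
Definition gorenstein (A B : set C) : set C :=
  [set M | exists X : set C, X M /\ forall L, X L ->
    (exists L', X L' /\ half_step A B L L') /\ (exists L', X L' /\ half_step A B L' L)].

Lemma isomorphic_sym L M : isomorphic L M -> isomorphic M L.
Proof. by move=> [f [g [gf fg]]]; exists g, f. Qed.

Lemma isomorphic_trans L M T : isomorphic L M -> isomorphic M T -> isomorphic L T.
Proof.
move=> [f [g [gf fg]]] [f' [g' [gf' fg']]]; exists (f' \oc f), (g \oc g'); split.
  by rewrite compA -(compA g) gf' compm1.
by rewrite compA -(compA f') fg compm1.
Qed.

Lemma isomorphic_refl L : isomorphic L L.
Proof. by exists (idm L), (idm L); rewrite comp1m. Qed.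

Lemma half_step_iso_l (A B : set C) L M (L' : C) :
  isomorphic M L -> half_step A B L L' -> half_step A B M L'.
Proof.
move=> [j ij] [U [f [g [s AU ext]]]]; exists U, (f \oc j), g; split=> //.
  exact: ses_iso_l.
move=> T BT h; have [j' [jj' j'j]] := ij.
have [h' hh'] := ext T BT (h \oc j'); exists h'.
by rewrite compA hh' -compA jj' compm1.
Qed.

Lemma half_step_iso_r (A B : set C) L M (L' : C) :
  isomorphic L' M -> half_step A B L L' -> half_step A B L M.
Proof.
move=> [j ij] [U [f [g [s AU ext]]]]; exists U, f, (j \oc g); split=> //.
exact: ses_iso_r.
Qed.

Lemma mono_epi_iso L M (f : hom L M) : is_mono f -> is_epi f -> is_iso f.
Proof.
move=> mf ef; have [D [g s]] := ses_of_mono mf.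
have [|y fy] := @ses_lift _ _ _ _ f g _ (idm M) s.
  by apply: ef; rewrite compm1 (ses0 s) comp0m.
by exists y; split=> //; apply: mf; rewrite compA fy comp1m compm1.
Qed.

Lemma kernel_iso A D K (K' : C) (f : hom A D) (k : hom K A) (k' : hom K' A) :
  is_kernel f k -> is_kernel f k' -> isomorphic K K'.
Proof.
move=> kk kk'; have [fk0 uk] := kk; have [fk'0 uk'] := kk'.
have [h [kh _]] := uk' _ _ fk0; have [h' [kh' _]] := uk _ _ fk'0.
exists h, h'; split.
  by apply: (kernel_mono kk); rewrite compA kh' kh compm1.
by apply: (kernel_mono kk'); rewrite compA kh kh' compm1.
Qed.

(** Keeping [R] a relation between points avoids transporting morphisms along the
    equations between integer indices. *)
Lemma int_chain (S : Type) (X : S -> Prop) (R : S -> S -> Prop) s : X s ->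
  (forall x, X x -> (exists y, X y /\ R x y) /\ (exists y, X y /\ R y x)) ->
  exists f : int -> S, f 0 = s /\ forall k : int, R (f k) (f (k - 1)).
Proof.
move=> Xs h.
pose dn (x : {x | X x}) : {x | X x} :=
  let w := cid ((h _ (svalP x)).1) in exist _ (sval w) (svalP w).1.
pose up (x : {x | X x}) : {x | X x} :=
  let w := cid ((h _ (svalP x)).2) in exist _ (sval w) (svalP w).1.
have dnR x : R (sval x) (sval (dn x)) by exact: (svalP (cid ((h _ (svalP x)).1))).2.
have upR x : R (sval (up x)) (sval x) by exact: (svalP (cid ((h _ (svalP x)).2))).2.
pose s0 : {x | X x} := exist _ s Xs.
exists (fun k => match k with Posz n => sval (iter n up s0) | Negz n => sval (iter n.+1 dn s0) end).
split=> // -[[|n]|n].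
- by have -> : (0 - 1 : int) = Negz 0 by []; apply: dnR.
- have -> : (Posz n.+1 - 1 : int) = Posz n by rewrite -addn1 PoszD addrK.
  exact: upR.
have -> : (Negz n - 1 : int) = Negz n.+1 by rewrite !NegzE -opprD -PoszD addn1.
exact: dnR.
Qed.

Lemma complex_cycles (P : int -> C) (d : forall k, hom (P k) (P (k - 1))) :
  (forall k : int, exact (d k) (d (k - 1))) ->
  exists (Zc : int -> C) (i : forall k, hom (Zc k) (P k)) (q : forall k, hom (P k) (Zc (k - 1))),
    forall k, [/\ is_kernel (d k) (i k), short_exact (i k) (q k) & i (k - 1) \oc q k = d k].
Proof.
move=> ex; pose Zc k := sval (cid (abelian_kernel (d k))).
pose i k : hom (Zc k) (P k) := sval (cid (svalP (cid (abelian_kernel (d k))))).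
have ki k : is_kernel (d k) (i k) := svalP (cid (svalP (cid (abelian_kernel (d k))))).
have mi k := kernel_mono (ki k).
have hq k : exists q : hom (P k) (Zc (k - 1)), i (k - 1) \oc q = d k.
  have [_ u] := ki (k - 1); have [q [iq _]] := u _ _ (exact0 (ex k)).
  by exists q.
pose q k := sval (cid (hq k)); have iq k : i (k - 1) \oc q k = d k := svalP (cid (hq k)).
exists Zc, i, q => k; split=> //; apply: kernel_ses.
  apply: epiI => T x.
  have [|T' [r [a [er da]]]] := @exact_lift _ _ _ _ _ _ _ (i (k - 1) \oc x) (ex k).
    by have [e0 _] := ki (k - 1); rewrite compA e0 comp0m.
  by exists T', r, a; split=> //; apply: (mi (k - 1)); rewrite !compA iq.
have [di u] := ki k; split.
  by apply: (mi (k - 1)); rewrite compA iq di compm0.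
by move=> T x qx; apply: u; rewrite -iq -compA qx compm0.
Qed.

Lemma complex_of_ses (Zc P : int -> C) (i : forall k, hom (Zc k) (P k))
    (q : forall k, hom (P k) (Zc (k - 1))) :
  (forall k, short_exact (i k) (q k)) ->
  (forall k : int, is_kernel (i (k - 1) \oc q k) (i k)) /\
  (forall k : int, exact (i (k - 1) \oc q k) (i (k - 1 - 1) \oc q (k - 1))).
Proof.
move=> s.
have ki (k : int) : is_kernel (i (k - 1) \oc q k) (i k).
  split; first by rewrite -compA (ses0 (s k)) compm0.
  have [mi _ _] := s k; have [mi' _ _] := s (k - 1).
  move=> T x; rewrite -compA => /((monoP _).1 mi')/(ses_lift (s k))[y iy].
  by exists y; split=> // z iz; apply: mi; rewrite iy iz.
split=> // k; exists (Zc (k - 1)), (i (k - 1)), (q k); split=> //.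
by have [] := s k.
Qed.

(** A complex is cut into the short exact sequences of its cycles, and conversely
    the sequences of a chain are spliced. *)
Lemma GProj_gorenstein (A B : set C) : GProj A B = gorenstein A B.
Proof.
apply/seteqP; split=> M.
  move=> [P [d [ex AP acy [Z0 [i0 [k0 isoM]]]]]].
  have [Zc [i [q h]]] := complex_cycles ex.
  have ext (k : int) T : B T -> forall x : hom (Zc k) T, exists x', x' \oc i k = x.
    move=> BT; have : forall x : hom (Zc (k + 1 + 1 - 1 - 1)) T, exists x', x' \oc i _ = x.
      (* [x] composed with P_(j-1) -> Z_(j-1-1) is a cocycle in degree j - 1 *)
      set j := k + 1 + 1 => x; have [_ s1 dE] := h (j - 1); have [_ _ eq1] := s1.
      have [|x' x'd] := (acy T BT j (x \oc q (j - 1))).1.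
        have [_ _ dj] := h j.
        by rewrite /precomp -dj -compA (compA (q _)) (ses0 s1) comp0m compm0.
      by exists x'; apply: eq1; rewrite -x'd /precomp -dE compA.
    by rewrite !addrK; apply.
  have st (k : int) : half_step A B (Zc k) (Zc (k - 1)).
    by have [_ s _] := h k; exists (P k), (i k), (q k); split=> // T BT; apply: ext.
  exists [set L | exists k, isomorphic L (Zc k)]; split.
    have [k1 _ _] := h 0.
    by exists 0; apply: (isomorphic_trans isoM); apply: (kernel_iso k0 k1).
  move=> L [k isoL]; split.
    exists (Zc (k - 1)); split; first by exists (k - 1); apply: isomorphic_refl.
    exact: half_step_iso_l isoL (st k).
  exists (Zc (k + 1)); split; first by exists (k + 1); apply: isomorphic_refl.
  apply: (half_step_iso_r (isomorphic_sym isoL)).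
  by have := st (k + 1); rewrite addrK.
move=> [X [XM hX]]; have [Zc [Z0 st]] := int_chain XM hX.
pose P k := sval (cid (st k)).
have hP k := svalP (cid (st k)); pose i k : hom (Zc k) (P k) := sval (cid (hP k)).
have hi k := svalP (cid (hP k)); pose q k : hom (P k) (Zc (k - 1)) := sval (cid (hi k)).
have hq (k : int) : [/\ short_exact (i k) (q k), A (P k) &
  forall T, B T -> forall x : hom (Zc k) T, exists x', x' \oc i k = x] := svalP (cid (hi k)).
have s k : short_exact (i k) (q k) by have [] := hq k.
have [ki ex] := complex_of_ses s.
exists P, (fun k => i (k - 1) \oc q k); split=> //.
- by move=> k; have [] := hq k.
- move=> T BT k y; split=> [|[x <-]]; last first.
    by rewrite /precomp -!compA (compA (q (k - 1))) (ses0 (s (k - 1))) comp0m !compm0.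
  rewrite /precomp compA => yd.
  have yi : y \oc i (k - 1) = 0 by have [_ _ eq] := s k; apply: eq; rewrite yd comp0m.
  have [z zq] := ses_desc (s (k - 1)) yi.
  have [_ _ ext] := hq (k - 1 - 1); have [x xi] := ext T BT z.
  by exists x; rewrite compA xi.
by exists (Zc 0), (i 0); split; [exact: ki | rewrite Z0; apply: isomorphic_refl].
Qed.

End Bisimulation.

Section BisimulationDual.
Local Open Scope ring_scope.
Context {C : abelianCat}.
Implicit Types A D K L M T U Z : C.

Lemma GInj_gorenstein (Z W : set C) : GInj Z W = @gorenstein (op C) W Z.
Proof.
have stE L L' (U : C) (f : hom L' U) (g : hom U L) : short_exact f g -> W U ->
   (forall T, Z T -> forall h : hom T L, exists h', g \oc h' = h) ->
   @half_step (op C) W Z L L'.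
  by move=> s WU ext; exists U, g, f; split=> //; apply: (@short_exact_op C L' U L f g).1.
apply/seteqP; split=> M.
  move=> [P [d [ex WP acy [Z0 [i0 [k0 isoM]]]]]].
  have [Zc [i [q h]]] := complex_cycles ex.
  have st (k : int) : @half_step (op C) W Z (Zc (k - 1)) (Zc k).
    have [ki s dE] := h k; apply: (stE _ _ _ _ _ s) => // T ZT x.
    have [|y dy] := (acy T ZT k (i (k - 1) \oc x)).1.
      by have [[e0 _] _ _] := h (k - 1); rewrite /postcomp compA e0 comp0m.
    have [[_ _] [mi _ _] _] := h (k - 1).
    by exists y; apply: mi; rewrite -dy /postcomp -dE compA.
  have iso_op (L L' : C) : isomorphic L L' -> @isomorphic (op C) L L'.
    by move=> [f [g [gf fg]]]; exists g, f.
  exists [set L | exists k, @isomorphic C L (Zc k)]; split.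
    have [k1 _ _] := h 0.
    by exists 0; apply: (isomorphic_trans isoM); apply: (kernel_iso k0 k1).
  move=> L [k isoL]; split.
    exists (Zc (k + 1)); split; first by exists (k + 1); apply: isomorphic_refl.
    apply: (half_step_iso_l (iso_op _ _ isoL)).
    by have := st (k + 1); rewrite addrK.
  exists (Zc (k - 1)); split; first by exists (k - 1); apply: isomorphic_refl.
  exact: half_step_iso_r (iso_op _ _ (isomorphic_sym isoL)) (st k).
move=> [X [XM hX]].
have [|Zc [Z0 st]] := @int_chain C X (fun x y => @half_step (op C) W Z y x) M XM.
  by move=> x /hX[].
have st' (k : int) : exists (P : C) (i : hom (Zc k) P) (q : hom P (Zc (k - 1))),
    [/\ short_exact i q, W P &
      forall T, Z T -> forall h : hom T (Zc (k - 1)), exists h', q \oc h' = h].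
  have [P [q [i [s WP ext]]]] := st k; exists P, i, q; split=> //.
  exact: (@short_exact_op C _ _ _ i q).2.
pose P k := sval (cid (st' k)).
have hP k := svalP (cid (st' k)); pose i k : hom (Zc k) (P k) := sval (cid (hP k)).
have hi k := svalP (cid (hP k)); pose q k : hom (P k) (Zc (k - 1)) := sval (cid (hi k)).
have hq (k : int) : [/\ short_exact (i k) (q k), W (P k) &
  forall T, Z T -> forall x : hom T (Zc (k - 1)), exists x', q k \oc x' = x] := svalP (cid (hi k)).
have s k : short_exact (i k) (q k) by have [] := hq k.
have [ki ex] := complex_of_ses s.
exists P, (fun k => i (k - 1) \oc q k); split=> //.
- by move=> k; have [] := hq k.
- move=> T ZT k y; split=> [|[x <-]]; last first.
    by rewrite /postcomp -!compA (compA (q (k - 1))) (ses0 (s (k - 1))) comp0m !compm0.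
  rewrite /postcomp -compA => yd.
  have yq : q (k - 1) \oc y = 0.
    by have [mi _ _] := s (k - 1 - 1); apply: mi; rewrite yd compm0.
  have [z zq] := ses_lift (s (k - 1)) yq.
  have [_ _ ext] := hq k; have [x xi] := ext T ZT z.
  by exists x; rewrite -compA xi.
by exists (Zc 0), (i 0); split; [exact: ki | rewrite Z0; apply: isomorphic_refl].
Qed.

End BisimulationDual.

(** * Finite resolutions as iterated short exact sequences *)

(** Existence of a resolution of length n, recorded syzygy by syzygy; this is the
    form suited to induction on n. *)
Fixpoint ses_resdim (C : abelianCat) (X : set C) (n : nat) (M : C) : Prop :=
  match n with
  | 0 => X M
  | S n => exists (K G : C) (f : hom K G) (g : hom G M),
      [/\ short_exact f g, X G & ses_resdim X n K]
  end.

Section FiniteResolutions.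
Local Open Scope ring_scope.
Context {C : abelianCat}.
Implicit Types A D K L M T U Z : C.

Lemma gorenstein_iso (A B : set C) : iso_closed (gorenstein A B).
Proof.
move=> M L isoM; rewrite -GProj_gorenstein => -[P [d [h1 h2 h3 [Z0 [i [ki isoZ]]]]]].
exists P, d; split=> //; exists Z0, i; split=> //.
exact: isomorphic_trans (isomorphic_sym isoM) isoZ.
Qed.

Lemma has_finite_resolution_ses (X : set C) n M : iso_closed X ->
  has_finite_resolution X n M <-> ses_resdim X n M.
Proof.
move=> isoX; elim: n M => [|n IH] M; split.
- move=> [P [d [e [[ee ex0 _] XP zP]]]]; apply: (isoX (P 0%N)); last exact: XP.
  exists e; apply: mono_epi_iso => //; apply/monoP => T x ex.
  have [T' [q [a [eq da]]]] := exact_lift ex0 ex.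
  apply: ((epiP q).1 eq); rewrite -da.
  by have [z0 _] := zP 1%N isT (P 0%N); rewrite (z0 (d 0%N)) comp0m.
- move=> XM; exists (resol_self M), (rd (resol_self M)), (re (resol_self M)); split.
  + exact: resolP.
  + by case.
  + by case=> // k _; apply: zeroCP.
- move=> [P [d [e [res XP zP]]]].
  have [K [f [e' [s fe res']]]] := resolution_tail res.
  exists K, (P 0%N), f, e; split=> //; first exact: XP.
  apply/IH; exists (fun k => P k.+1), (fun k => d k.+1), e'; split=> // k hk; first exact: XP.
  exact: zP.
move=> [K [G [f [g [s XG /IH[P [d [e [res XP zP]]]]]]]]].
exists (cons_obj G P), (cons_d d (f \oc e)), g; split; first exact: cons_resolution s res.
  by case=> [|k] //= hk; apply: XP.
by case=> [|k] //= hk; apply: zP.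
Qed.

Lemma is_coresolution_op M (I : nat -> C) (d : forall k, hom (I k) (I k.+1)) (e : hom M (I 0)) :
  is_coresolution d e <-> @is_resolution (op C) M I d e.
Proof.
split=> -[h1 h2 h3]; split=> //.
- exact: (exact_op e (d 0%N)).1.
- by move=> k; apply: (exact_op (d k) (d k.+1)).1.
- exact: (exact_op e (d 0%N)).2.
- by move=> k; apply: (exact_op (d k) (d k.+1)).2.
Qed.

Lemma is_zero_op Z : is_zero Z -> @is_zero (op C) Z.
Proof. by move=> h A; have [] := h A. Qed.

Lemma has_finite_coresolution_op (X : set C) n M :
  has_finite_coresolution X n M <-> @has_finite_resolution (op C) X n M.
Proof.
split=> -[I [d [e [res XI zI]]]]; exists I, d, e; split=> //.
- exact/is_coresolution_op.
- by move=> k /zI /is_zero_op.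
- exact/is_coresolution_op.
- by move=> k /zI h A; have [] := h A.
Qed.

Lemma has_acyclic_coresolution_op (Y X : set C) M :
  has_acyclic_coresolution Y X M -> @has_acyclic_resolution (op C) Y X M.
Proof.
move=> [I [d [e [res XI h]]]]; exists I, d, e; split=> //.
exact/is_coresolution_op.
Qed.

End FiniteResolutions.

(** * Dimensions *)

Lemma enat_le_least (P : set nat) n : (forall m, P m -> P m.+1) ->
  enat_le (enat_least P) (Some n) <-> P n.
Proof.
move=> up; have up' m k : (m <= k)%N -> P m -> P k.
  move=> /subnKC <-; elim: (k - m)%N => [|j IH]; first by rewrite addn0.
  by move=> /IH /up; rewrite addnS.
rewrite /enat_least; case: pselect => [ex|nex] /=; last first.
  by split=> // Pn; case: nex; exists n; apply/asboolP.
case: ex_minnP => m Pm' min; have Pm := asboolW Pm'; split=> [mn|Pn]; first exact: (up' m n mn Pm).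
by apply: min; apply/asboolP.
Qed.

Lemma enat_le_sup (S S' : set enat) :
  (forall n, (forall x, S' x -> enat_le x (Some n)) -> forall x, S x -> enat_le x (Some n)) ->
  enat_le (enat_sup S) (enat_sup S').
Proof.
have supP (R : set enat) n : enat_le (enat_sup R) (Some n) <-> forall x, R x -> enat_le x (Some n).
  apply: enat_le_least => m h [k|] /h //= /leqW //.
move=> h; case e: (enat_sup S') => [n|]; last by case: (enat_sup S).
by apply/supP/h/supP; rewrite e /=.
Qed.

Lemma enat_least_neq_None (P : set nat) : enat_least P <> None -> exists n, P n.
Proof. by rewrite /enat_least; case: pselect => // ex _; case: ex => n /asboolW; exists n. Qed.

(** * Relative Gorenstein projective dimension *)

(** [E n M T] stands for Ext^(n+1)(M, T) = 0. It is abstract because it will be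
    instantiated with [ext_vanish] in a category and, with its two arguments
    exchanged, in the opposite category. *)
Section Gorenstein.
Local Open Scope ring_scope.
Context {C : abelianCat}.
Implicit Types D G K L M N P Q T U X Y Z : C.

Variables (A B : set C) (E : nat -> C -> C -> Prop).
Hypothesis E_splits : forall M T, E 0 M T -> ext_splits M T.
Hypothesis E_shift : forall n K X Z T (f : hom K X) (g : hom X Z),
  short_exact f g -> E n.+1 Z T -> E n X T -> E n K T.
Hypothesis E_AB : forall n M T, A M -> B T -> E n M T.
Hypothesis A_zero : forall Z, is_zero Z -> A Z.
Hypothesis A_ext : extension_closed A.
Hypothesis A_epi : forall M, exists X (p : hom X M), A X /\ is_epi p.
Hypothesis A_embed : forall M, A M ->
  exists W M' (f : hom M W) (g : hom W M'), [/\ short_exact f g, (A `&` B) W & A M'].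

Lemma A_cover M : exists K X (f : hom K X) (g : hom X M), short_exact f g /\ A X.
Proof.
have [X [p [AX ep]]] := A_epi M; have [K [f s]] := ses_of_epi ep.
by exists K, X, f, p.
Qed.

(** Ext^(n+1)(M, B) = 0, computed from A-covers: objects of A being acyclic for
    Hom(-, B), Ext^(n+1)(M, B) is Ext^1(-, B) of an n-th syzygy of M. In this form the
    long exact sequence follows from diagrams of short exact sequences alone. *)
Fixpoint ext_acyclic (n : nat) (M : C) : Prop :=
  match n with
  | 0 => forall T, B T -> ext_splits M T
  | S n => forall K X (f : hom K X) (g : hom X M), short_exact f g -> A X -> ext_acyclic n K
  end.

Lemma ext_acyclicI n M : (forall T, B T -> E n M T) -> ext_acyclic n M.
Proof.
elim: n M => [|n IH] M h; first by move=> T /h /E_splits.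
by move=> K X f g s AX; apply: IH => T BT; apply: (E_shift s (h T BT)); apply: E_AB.
Qed.

Lemma ext_acyclic_A n M : A M -> ext_acyclic n M.
Proof. by move=> AM; apply: ext_acyclicI => T; apply: E_AB. Qed.

(** The three two-out-of-three consequences of the long exact sequence for
    Ext(-, B), proved simultaneously: covering the middle or the last term by an
    object of A reduces each of them to another one, either in degree n or just
    proved in degree n + 1. *)
Lemma ext_acyclic_les n :
  [/\ forall L M N (f : hom L M) (g : hom M N), short_exact f g ->
        ext_acyclic n L -> ext_acyclic n N -> ext_acyclic n M,
      forall L M N (f : hom L M) (g : hom M N), short_exact f g ->
        ext_acyclic n M -> ext_acyclic n.+1 N -> ext_acyclic n L
    & forall L M N (f : hom L M) (g : hom M N), short_exact f g ->
        ext_acyclic n L -> ext_acyclic n.+1 M -> ext_acyclic n.+1 N].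
Proof.
elim: n => [|n [IH1 IH2 IH3]].
  have mid L M N (f : hom L M) (g : hom M N) : short_exact f g ->
      ext_acyclic 0 L -> ext_acyclic 0 N -> ext_acyclic 0 M.
    by move=> s hL hN T BT; apply: (ext_splits_mid_l s); [apply: hL | apply: hN].
  have lft L M N (f : hom L M) (g : hom M N) : short_exact f g ->
      ext_acyclic 0 M -> ext_acyclic 1 N -> ext_acyclic 0 L.
    move=> s hM hN T BT.
    have [K [X [k [p [sk AX]]]]] := A_cover M.
    have [Q [n [l [m [sn sl nl _]]]]] := ses_comp_epi sk s.
    apply: (ext_splits_quot sl); first exact: hN sn AX _ BT.
    move=> h; have [h' hk] := ext_splits_extend h sk (hM _ BT).
    by exists (h' \oc n); rewrite -compA nl.
  split=> // L M N f g s hL hM K X k p sk AX.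
  have [P [u [v [i [_ sv _ h]]]]] := ses_pullback p s.
  have [j [sj _ _]] := h _ _ sk.
  by apply: (lft _ _ _ _ _ sj) => //; apply: (mid _ _ _ _ _ sv) => //; apply: ext_acyclic_A.
have mid L M N (f : hom L M) (g : hom M N) : short_exact f g ->
    ext_acyclic n.+1 L -> ext_acyclic n.+1 N -> ext_acyclic n.+1 M.
  move=> s hL hN K X k p sk AX.
  have [Q [q [l [m [sn sl _ _]]]]] := ses_comp_epi sk s.
  by apply: (IH2 _ _ _ _ _ sl) => //; apply: hN sn AX.
have lft L M N (f : hom L M) (g : hom M N) : short_exact f g ->
    ext_acyclic n.+1 M -> ext_acyclic n.+2 N -> ext_acyclic n.+1 L.
  move=> s hM hN; have [K [X [k [p [sk AX]]]]] := A_cover M.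
  have [Q [q [l [m [sn sl _ _]]]]] := ses_comp_epi sk s.
  by apply: (IH3 _ _ _ _ _ sl); [apply: hM sk AX | apply: hN sn AX].
split=> // L M N f g s hL hM K X k p sk AX.
have [P [u [v [i [_ sv _ h]]]]] := ses_pullback p s.
have [j [sj _ _]] := h _ _ sk.
by apply: (lft _ _ _ _ _ sj) => //; apply: (mid _ _ _ _ _ sv) => //; apply: ext_acyclic_A.
Qed.

Definition left_perp : set C := [set M | forall n, ext_acyclic n M].

Lemma left_perp_ext : extension_closed left_perp.
Proof.
by move=> L M N f g s hL hN n; have [h _ _] := ext_acyclic_les n; apply: (h _ _ _ _ _ s).
Qed.

Lemma left_perp_ker L M N (f : hom L M) (g : hom M N) :
  short_exact f g -> left_perp M -> left_perp N -> left_perp L.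
Proof. by move=> s hM hN n; have [_ h _] := ext_acyclic_les n; apply: (h _ _ _ _ _ s). Qed.

(** The terms of the coresolutions of [gproj] below are taken from A intersected with
    this class rather than from A intersected with B: the former is stable under
    extensions and still Ext-injective relative to [left_perp], which is all that
    the horseshoe needs. *)
Definition right_perp : set C := [set T | forall M, left_perp M -> ext_splits M T].

Lemma B_right_perp T : B T -> right_perp T.
Proof. by move=> BT M /(_ 0%N); apply. Qed.

Definition cogenerators : set C := A `&` right_perp.

Lemma cogenerators_ext : extension_closed cogenerators.
Proof.
move=> L N M f g s [AL rL] [AN rN]; split; first exact: A_ext s AL AN.
by move=> Q hQ; apply: (ext_splits_mid_r s); [apply: rL | apply: rN].
Qed.

Definition cogen_step (X : set C) L : Prop :=
  exists U L' (f : hom L U) (g : hom U L'), [/\ short_exact f g, cogenerators U & X L'].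

(** Half of the definition of Gorenstein projectives: objects acyclic for Hom(-, B)
    with a one-sided coresolution. It is a largest class (coinduction), so that
    membership is proved by exhibiting a class closed under [cogen_step]. *)
Definition gproj : set C :=
  [set M | exists X : set C, [/\ X M, X `<=` left_perp & forall L, X L -> cogen_step X L]].

Lemma gproj_left_perp : gproj `<=` left_perp.
Proof. by move=> M [X [XM h _]]; apply: h. Qed.

Lemma gproj_step M : gproj M -> cogen_step gproj M.
Proof.
move=> [X [XM h1 h2]]; have [U [L [f [g [s cU XL]]]]] := h2 _ XM.
by exists U, L, f, g; split=> //; exists X.
Qed.

Lemma gprojI M : left_perp M -> cogen_step gproj M -> gproj M.
Proof.
move=> pM sM; exists (gproj `|` [set M]); split; [by right | |].
  by move=> L [/gproj_left_perp | ->].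
move=> L hL; have [U [L' [f [g [s cU gL]]]]] : cogen_step gproj L.
  by case: hL => [/gproj_step | ->].
by exists U, L', f, g; split=> //; left.
Qed.

(** The class of extensions of members of [gproj] is itself closed under [cogen_step]:
    the horseshoe turns steps of the two ends into a step of the middle. *)
Lemma gproj_ext : extension_closed gproj.
Proof.
move=> G L K i k s gG gK.
exists [set L | exists G K (i : hom G L) (k : hom L K), [/\ short_exact i k, gproj G & gproj K]].
split; first by exists G, K, i, k.
  move=> L' [? [? [? [? [s' /gproj_left_perp p1 /gproj_left_perp p2]]]]].
  exact: left_perp_ext s' p1 p2.
move=> {}L [{}G [{}K [{}i [{}k [{}s {}gG {}gK]]]]].
have [U1 [G2 [a [b [sa c1 gG2]]]]] := gproj_step gG.
have [U2 [K2 [c [d [sc c2 gK2]]]]] := gproj_step gK.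
have [t ti] := ext_splits_extend a s (c1.2 _ (gproj_left_perp gK)).
have [X [N [[e [p se]] [m [n sm]] [u [v su]]]]] := horseshoe s sa sc ti.
exists X, N, e, p; split=> //; first exact: cogenerators_ext su c1 c2.
by exists G2, K2, m, n.
Qed.

Lemma gproj_A : A `<=` gproj.
Proof.
move=> M AM; exists A; split=> //; first by move=> L AL n; apply: ext_acyclic_A.
move=> L AL; have [W [L' [f [g [s [AW BW] AL']]]]] := A_embed AL.
by exists W, L', f, g; split=> //; split=> //; apply: B_right_perp.
Qed.

(** The composite L -> M -> U is a mono whose cokernel is an extension of members of
    [gproj]. *)
Lemma gproj_ker L M N (f : hom L M) (g : hom M N) :
  short_exact f g -> gproj M -> gproj N -> gproj L.
Proof.
move=> s gM gN; apply: gprojI; first by apply: (left_perp_ker s); apply: gproj_left_perp.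
have [U [M' [h [k [sh cU gM']]]]] := gproj_step gM.
have [Q [q [l [m [sq sl]]]]] := ses_comp_mono s sh.
by exists U, Q, (h \oc f), q; split=> //; apply: gproj_ext sl gN gM'.
Qed.

(** The bound on the dimension drops by one for any first syzygy. Pulling back two covers of M
    against each other gives an object P which is an extension in two ways, so the
    statement goes hand in hand with stability of the dimension under extensions by
    members of [gproj]; the latter in dimension n + 1 needs the former in
    dimension n. *)
Lemma ses_resdim_syzygy n M D Y (d : hom D Y) (e : hom Y M) :
  short_exact d e -> gproj Y -> ses_resdim gproj n.+1 M -> ses_resdim gproj n D.
Proof.
suff [] : (forall K P Y (i : hom K P) (q : hom P Y), short_exact i q ->
    ses_resdim gproj n K -> gproj Y -> ses_resdim gproj n P) /\
  (forall M D Y (d : hom D Y) (e : hom Y M), short_exact d e -> gproj Y ->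
    ses_resdim gproj n.+1 M -> ses_resdim gproj n D) by move=> _; apply.
elim: n {M D Y d e} => [|n [IH1 IH2]].
  have ext K P Y (i : hom K P) (q : hom P Y) : short_exact i q ->
    ses_resdim gproj 0 K -> gproj Y -> ses_resdim gproj 0 P by apply: gproj_ext.
  split=> // M D Y d e s gY [K [X [f [g [sf gX gK]]]]].
  have [P [p [q [i [_ si _ h]]]]] := ses_pullback e sf.
  have [j [sj _ _]] := h _ _ s.
  by apply: (gproj_ker sj) => //; apply: (ext _ _ _ _ _ si).
have ext K P Y (i : hom K P) (q : hom P Y) : short_exact i q ->
    ses_resdim gproj n.+1 K -> gproj Y -> ses_resdim gproj n.+1 P.
  (* the kernel [Q] of X -> P -> Y lies in [gproj] and covers K with kernel [N] *)
  move=> s hK gY; have [N [X [f [g [sf AX]]]]] := A_cover P.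
  have [Q [u [l [m [su sl _ _]]]]] := ses_comp_epi sf s.
  have gX := gproj_A AX; exists N, X, f, g; split=> //.
  by apply: (IH2 _ _ _ _ _ sl) => //; apply: (gproj_ker su).
split=> // M D Y d e s gY [K [X [f [g [sf gX hK]]]]].
have [P [p [q [i [_ si _ h]]]]] := ses_pullback e sf.
have [j [sj _ _]] := h _ _ s.
have [P' [X' [f' [g' [sf' gX' hP']]]]] := ext _ _ _ _ _ si hK gY.
have [Q [u [l [m [su sl _ _]]]]] := ses_comp_epi sf' sj.
by exists P', Q, l, m; split=> //; apply: (gproj_ker su).
Qed.

(** Objects with a resolution by A intersected with B all of whose syzygies K satisfy
    Ext^1(U, K) = 0 for U in A intersected with B. *)
Definition proper_resolved : set C :=
  [set L | exists X : set C, X L /\ forall M, X M ->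
    (forall U, (A `&` B) U -> ext_splits U M) /\
    exists K U (f : hom K U) (g : hom U M), [/\ short_exact f g, (A `&` B) U & X K]].

(** Induction on n by passing from L to the first syzygy of its proper resolution, to
    which the periodic sequence descends by the horseshoe. *)
Lemma periodic_resdim n L Q (f : hom L Q) (g : hom Q L) :
  short_exact f g -> proper_resolved L -> (exists m, forall k, (m <= k)%N -> ext_acyclic k L) ->
  ses_resdim gproj n Q -> ses_resdim gproj n L.
Proof.
elim: n L Q f g => [|n IH] L Q f g s [X [XL hX]] [m hm] hQ.
  have pL : left_perp L.
    (* descending induction on the degree: L is both the sub- and the quotient object *)
    have {}hm k j : (m <= k + j)%N -> ext_acyclic k L.
      elim: j k => [|j IHj] k; first by rewrite addn0 => /hm.
      rewrite addnS -addSn => /IHj hk.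
      have [_ h _] := ext_acyclic_les k.
      by apply: (h _ _ _ _ _ s) => //; apply: (gproj_left_perp hQ).
    by move=> k; apply: (hm k m); rewrite leq_addl.
  (* The cokernel of L -> Q -> U is an extension of a member of [gproj] by L again,
     so the extensions of members of [gproj] by L form a class closed under steps. *)
  exists [set M | exists G (i : hom L M) (k : hom M G), short_exact i k /\ gproj G].
  split.
  - exists zeroC, (idm L), 0; split; first exact: ses_id_r zeroCP.
    by apply: gproj_A; apply: A_zero zeroCP.
  - by move=> M [G [i [k [sM /gproj_left_perp pG]]]]; apply: left_perp_ext sM pL pG.
  move=> M [G [i [k [sM gG]]]].
  have [U [Q' [a [b [sa cU gQ']]]]] := gproj_step hQ.
  have [L1 [q [l [r [sq sl]]]]] := ses_comp_mono s sa.
  have [U2 [G2 [c [d [sc c2 gG2]]]]] := gproj_step gG.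
  have [t ti] := ext_splits_extend (a \oc f) sM (cU.2 _ (gproj_left_perp gG)).
  have [Y [N [[e [p se]] [u [v sN]] [x [y sY]]]]] := horseshoe sM sq sc ti.
  exists Y, N, e, p; split=> //; first exact: cogenerators_ext sY cU c2.
  have [N' [n' [l' [r' [s1 s2]]]]] := ses_comp_mono sl sN.
  by exists N', (u \oc l), n'; split=> //; apply: gproj_ext s2 gQ' gG2.
have [_ [K [U [h [k [sU ABU XK]]]]]] := hX _ XL.
have [t gt] := ext_splits_lift k s ((hX _ XL).1 _ ABU).
have [Y [N [[e [p se]] [u [v sN]] [x [y sY]]]]] := horseshoe_op s sU sU gt.
exists K, U, h, k; split=> //; first exact: gproj_A ABU.1.
apply: (IH _ _ _ _ sN).
- by exists X.
- exists m => j mj; have [_ h' _] := ext_acyclic_les j.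
  apply: (h' _ _ _ _ _ sU); first exact: ext_acyclic_A ABU.1.
  by apply: hm; apply: leqW.
by apply: (ses_resdim_syzygy se) => //; apply: gproj_ext sY _ _; apply: gproj_A ABU.1.
Qed.

(** * Periodic Gorenstein objects *)

Lemma gorenstein_left_perp (X : set C) : (forall L, X L -> exists L', X L' /\ half_step A B L' L) ->
  X `<=` left_perp.
Proof.
move=> h L XL n; elim: n L XL => [|n IH] L XL.
  have [L' [XL' [U [f [g [s AU ext]]]]]] := h _ XL.
  move=> T BT; apply: (ext_splits_quot s); last exact: ext.
  exact: (@ext_acyclic_A 0 U AU T BT).
have [L' [XL' [U [f [g [s AU ext]]]]]] := h _ XL.
by have [_ _ h3] := ext_acyclic_les n; apply: (h3 _ _ _ _ _ s); [apply: IH | apply: ext_acyclic_A].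
Qed.

(** The members of A in the coresolution of a Gorenstein projective need not be
    Ext-injective. The class used to replace them consists of the extensions
    0 -> M -> L -> A' -> 0 with M Gorenstein projective and A' in A: pushing out along a
    step M -> A0 embeds L into an object of A, hence into one of A intersected with B,
    and the cokernel is of the same kind. Conversely the missing left half
    of the complex is provided by A-covers, since [gproj] is closed under kernels
    of epimorphisms. *)
Lemma gorenstein_gproj : gorenstein A B = gproj.
Proof.
apply/seteqP; split=> M.
  move=> [X [XM hX]].
  have pX : X `<=` left_perp by apply: gorenstein_left_perp => L /hX[].
  exists [set L | exists M A' (f : hom M L) (g : hom L A'), [/\ short_exact f g, X M & A A']].
  split.
  - exists M, zeroC, (idm M), 0; split=> //; first exact: ses_id_r zeroCP.
    exact: A_zero zeroCP.
  - move=> L [K [A' [f [g [s /pX pK AA']]]]]; apply: (left_perp_ext s pK).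
    by move=> n; apply: ext_acyclic_A.
  move=> L [K [A' [f [g [s XK AA']]]]].
  have [[K' [XK' [A0 [u [v [sK AA0 _]]]]]] _] := hX _ XK.
  have [L0 [p [q [i [j [sq sp _]]]]]] := ses_pushout s sK.
  have AL0 : A L0 by apply: A_ext sq AA0 AA'.
  have [U [L1 [a [b [sa [AU BU] AL1]]]]] := A_embed AL0.
  have [N [n [l [m [sn sl]]]]] := ses_comp_mono sp sa.
  exists U, N, (a \oc p), n; split=> //; last by exists K', L1, l, m.
  by split=> //; apply: B_right_perp.
move=> gM; exists gproj; split=> // L gL; split.
  have [U [L' [f [g [s [AU rU] gL']]]]] := gproj_step gL.
  exists L'; split=> //; exists U, f, g; split=> // T BT h.
  by apply: (ext_splits_extend _ s); apply: (gproj_left_perp gL' 0%N).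
have [K [X [f [g [s AX]]]]] := A_cover L.
exists K; split.
  apply: (gproj_ker s _ gL).
  exact: (gproj_A AX).
exists X, f, g; split=> // T BT h.
by apply: (ext_splits_extend _ s); apply: (gproj_left_perp gL 0%N).
Qed.

Lemma ses_resdim_leS n M : ses_resdim (gorenstein A B) n M -> ses_resdim (gorenstein A B) n.+1 M.
Proof.
elim: n M => [|n IH] M.
  move=> gM; exists zeroC, M, 0, (idm M); split=> //; first exact: ses_id_l zeroCP.
  rewrite /= gorenstein_gproj; exact/gproj_A/A_zero/zeroCP.
by move=> [K [G [f [g [s XG /IH hK]]]]]; exists K, G, f, g.
Qed.

Lemma acyclic_resolution_proper L : (forall U, (A `&` B) U -> ext_splits U L) ->
  has_acyclic_resolution (A `&` B) (A `&` B) L -> proper_resolved L.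
Proof.
move=> sL rL.
exists [set L | (forall U, (A `&` B) U -> ext_splits U L) /\
  has_acyclic_resolution (A `&` B) (A `&` B) L]; split=> // M [sM [P [d [e [res XP acy]]]]].
split=> //; have [K [f [e' [s fe res']]]] := resolution_tail res.
have [mf _ _] := s.
exists K, (P 0%N), f, e; split=> //; split.
  move=> U ABU; apply: (ext_splits_sub s).
    exact: (@ext_acyclic_A 0 U ABU.1 _ (XP 0%N).2).
  by have [h _ _] := acy U ABU.
exists (fun k => P k.+1), (fun k => d k.+1), e'; split=> // T ABT.
have [_ h0 hS] := acy T ABT; split=> // [h|y].
  have [|x dx] := (h0 (f \oc h)).1; first by rewrite /postcomp compA (ses0 s) comp0m.
  by exists x; apply: mf; rewrite -dx /postcomp -fe compA.
rewrite -(hS 0%N y) /postcomp -fe -compA; split=> [->|]; first by rewrite compm0.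
exact: (monoP f).1 mf _ _.
Qed.

Lemma periodic_gorenstein_resdim n L Q (f : hom L Q) (g : hom Q L) :
  short_exact f g -> (forall U, (A `&` B) U -> ext_splits U L) ->
  has_acyclic_resolution (A `&` B) (A `&` B) L ->
  (exists m, forall k T, (m <= k)%N -> B T -> E k L T) ->
  ses_resdim (gorenstein A B) n Q -> ses_resdim (gorenstein A B) n L.
Proof.
move=> s sL rL [m hm]; rewrite gorenstein_gproj.
apply: (periodic_resdim s).
  exact: acyclic_resolution_proper.
by exists m => k mk; apply: ext_acyclicI => T; apply: hm.
Qed.

End Gorenstein.

(** * Gorenstein dimensions of periodic objects *)

(** A zero object is the empty coproduct. *)
Lemma coproduct_closed_zero (C : abelianCat) (X : set C) Z :
  coproduct_closed X -> is_zero Z -> X Z.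
Proof.
move=> cX hZ; apply: (cX 0%N (fun=> Z) Z (fun=> idm Z)) => [T u|[]//].
by exists 0%R; split=> [[]//|v _]; rewrite ((hZ T).1 v).
Qed.

Lemma ext_zero_vanish_class (C : abelianCat) (X : set C) (M : C) n :
  (forall i T, (n < i)%N -> X T -> Ext_zero i M T) ->
  forall k T, (n <= k)%N -> X T -> ext_vanish k M T.
Proof. by move=> h k T nk XT; apply: ext_zero_vanish; apply: h. Qed.

Lemma Gpd_periodic_le (C : abelianCat) (A B nu : set C) (S : set C) (hAB : GP_admissible A B) :
  (forall N, S N -> exists V (f : hom N V) (g : hom V N), short_exact f g /\ nu V) ->
  (forall U N, (A `&` B) U -> S N -> Ext_zero 1 U N) ->
  (forall N, S N -> has_acyclic_resolution (A `&` B) (A `&` B) N) ->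
  enat_le (Gpd_class A B (S `&` finite_pd B)) (Gpd_class A B nu).
Proof.
move=> hS h2 h3.
have E_AB n M T : A M -> B T -> ext_vanish n M T.
  by move=> AM BT; apply: ext_zero_vanish; apply: (GP_ext hAB).
have A0 Z : is_zero Z -> A Z by apply: coproduct_closed_zero (GP_coprodA hAB).
have GE M n : enat_le (Gpd A B M) (Some n) <-> ses_resdim (gorenstein A B) n M.
  have isoG := @gorenstein_iso C A B.
  rewrite /Gpd /resdim GProj_gorenstein enat_le_least.
    exact: has_finite_resolution_ses.
  move=> m /(has_finite_resolution_ses m M isoG) hm.
  apply/(has_finite_resolution_ses m.+1 M isoG).
  exact: (ses_resdim_leS (@ext_vanish_splits C) (@ext_vanish_shift_l C) E_AB A0
    (GP_extclosed hAB) (GP_epi hAB) (GP_embed hAB) hm).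
apply: enat_le_sup => n hn _ [N [SN pdN] <-]; apply/GE.
have [V [f [g [s nuV]]]] := hS N SN.
apply: (periodic_gorenstein_resdim (@ext_vanish_splits C) (@ext_vanish_shift_l C) E_AB A0
    (GP_extclosed hAB) (GP_epi hAB) (GP_embed hAB) s).
- by move=> U ABU; apply: ext_vanish_splits; apply: ext_zero_vanish; apply: h2.
- exact: h3.
- have [m hm] := enat_least_neq_None pdN; exists m; exact: ext_zero_vanish_class hm.
by apply/GE; apply: hn; exists V.
Qed.

(** The same argument in [op C], with W and Z in the roles of A and B and with the
    vanishing of Ext read in its other variable. *)
Lemma Gid_periodic_le (C : abelianCat) (Z W om : set C) (S : set C) (hZW : GI_admissible Z W) :
  (forall M, S M -> exists U (f : hom M U) (g : hom U M), short_exact f g /\ om U) ->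
  (forall M V, S M -> (W `&` Z) V -> Ext_zero 1 M V) ->
  (forall M, S M -> has_acyclic_coresolution (W `&` Z) (W `&` Z) M) ->
  enat_le (Gid_class Z W (S `&` finite_id Z)) (Gid_class Z W om).
Proof.
move=> hS h2 h3.
pose E n (M T : op C) := @ext_vanish C n T M.
have E_splits (M T : op C) : E 0%N M T -> ext_splits M T.
  by move=> /ext_vanish_splits /ext_splits_op.
have E_shift n (K X Q T : op C) (f : hom K X) (g : hom X Q) :
    short_exact f g -> E n.+1 Q T -> E n X T -> E n K T.
  move=> s; apply: (@ext_vanish_shift_r C n T Q X K g f).
  exact: (@short_exact_op C Q X K g f).2.
have E_AB n (M T : op C) : W M -> Z T -> E n M T.
  by move=> WM ZT; apply: ext_zero_vanish; apply: (GI_ext hZW).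
have A0 (Q : op C) : is_zero Q -> W Q.
  move=> hQ; apply: (coproduct_closed_zero (GI_coprodW hZW)) => T.
  by have [] := hQ T.
have A_ext : @extension_closed (op C) W.
  move=> K X Q f g s WK WQ; apply: (GI_extclosed hZW) WQ WK.
  exact: (@short_exact_op C Q X K g f).2 s.
have A_epi (M : op C) : exists (X : op C) (p : hom X M), W X /\ is_epi p.
  exact: (GI_mono hZW M).
have A_embed (M : op C) : W M -> exists (V M' : op C) (f : hom M V) (g : hom V M'),
    [/\ short_exact f g, (W `&` Z) V & W M'].
  move=> /(GI_cover hZW)[V [M' [f [g [s [ZV WV] WM']]]]]; exists V, M', g, f.
  by split=> //; apply: (@short_exact_op C _ _ _ f g).1.
have GE M n : enat_le (Gid Z W M) (Some n) <-> @ses_resdim (op C) (@gorenstein (op C) W Z) n M.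
  have isoG := @gorenstein_iso (op C) W Z.
  have finP k : @has_finite_coresolution C (@gorenstein (op C) W Z) k M <->
      @ses_resdim (op C) (@gorenstein (op C) W Z) k M.
    have h := @has_finite_resolution_ses (op C) _ k M isoG.
    have h' := @has_finite_coresolution_op C (@gorenstein (op C) W Z) k M.
    exact: iff_trans h' h.
  rewrite /Gid /coresdim GInj_gorenstein enat_le_least; first exact: finP.
  move=> m /finP hm; apply/finP.
  exact: (ses_resdim_leS E_splits E_shift E_AB A0 A_ext A_epi A_embed hm).
apply: enat_le_sup => n hn _ [M [SM idM] <-]; apply/GE.
have [U [f [g [s omU]]]] := hS M SM.
apply: (periodic_gorenstein_resdim E_splits E_shift E_AB A0 A_ext A_epi A_embed
  ((@short_exact_op C _ _ _ f g).1 s)).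
- move=> V WZV; apply/(@ext_splits_op C); apply: ext_vanish_splits.
  by apply: ext_zero_vanish; apply: h2.
- exact: has_acyclic_coresolution_op (h3 _ SM).
- have [m hm] := enat_least_neq_None idM; exists m => k T mk ZT.
  by apply: ext_zero_vanish; apply: hm.
by apply/GE; apply: hn; exists U.
Qed.

Theorem lemma1p1 (C : abelianCat) (A B Z W omega nu : set C)
  (hAB : GP_admissible A B) (hZW : GI_admissible Z W)
  (homega : omega = A `&` B) (hnu : nu = Z `&` W)
  (h1omega : summand_closed omega) (h1nu : summand_closed nu)
  (h2P : forall M V : C, piGProj omega B M -> nu V -> Ext_zero 1 M V)
  (h2I : forall U N : C, omega U -> piGInj Z nu N -> Ext_zero 1 U N)
  (h3P : forall M : C, piGProj omega B M -> has_acyclic_coresolution nu nu M)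
  (h3I : forall N : C, piGInj Z nu N -> has_acyclic_resolution omega omega N) :
  enat_le (Gid_class Z W (piGProj omega B `&` finite_id Z)) (Gid_class Z W omega)
  /\
  enat_le (Gpd_class A B (piGInj Z nu `&` finite_pd B)) (Gpd_class A B nu).
Proof.
split.
  rewrite setIC in hnu; rewrite hnu in h2P h3P.
  apply: Gid_periodic_le => // M [U [f [g [s _ oU]]]].
  by exists U, f, g.
rewrite homega in h2I h3I.
apply: Gpd_periodic_le => // N [V [f [g [s _ nV]]]].
by exists V, f, g.
Qed.
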